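(* If the spindle $(X,\star)$ is finite, then for every $n\ge 0$ $$H^D_n(X,\partial^\star)\cong\bigoplus_{p=1}^n\widetilde H^N_{n-1-p}(X,\partial^\star)^{\oplus\frac{|X|}{1+|X|}\left(|X|^p-(-1)^p\right)}.$$
   Context: Let $R$ be a commutative ring with unit. A spindle is a set $X$ with a binary operation $\star$ such that $x\star x=x$ and $(x\star y)\star z=(x\star z)\star(y\star z)$. $C_n(X)=R\langle X^{n+1}\rangle$ ($n\ge0$) is the free $R$-module on sequences $(x_n,\dots,x_0)$, with differential $\partial^\star=\sum_{i=0}^n(-1)^{n-i}d_i^\star$, $d_i^\star(x_n,\dots,x_0)=(x_n\star x_i,\dots,x_{i+1}\star x_i,x_{i-1},\dots,x_0)$. The degenerate subcomplex $C^D(X)$ is spanned by sequences with $x_i=x_{i+1}$ for some $i$, and $H^D(X,\partial^\star)$ is its homology. The normalized complex is $C^N(X)=C(X)/C^D(X)$. The augmented normalized complex is $C^N(X)$ extended by $R$ in degree $-1$ with the map $\epsilon\colon C^N_0(X)=C_0(X)\to R$, $\epsilon(x)=1$; its homology is $\widetilde H^N(X,\partial^\star)$. *)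

(* Defs.v *)
From HB Require Import structures.
From mathcomp Require Import all_boot all_order all_algebra.
From mathcomp Require Import generic_quotient ring_quotient zify ring lra boolp.

Set Implicit Arguments.
Unset Strict Implicit.
Unset Printing Implicit Defensive.

Import Order.TTheory GRing.Theory Num.Theory.

Local Open Scope ring_scope.
Local Open Scope quotient_scope.

Section Submodule.
Variables (R : pzRingType) (V : lmodType R) (S : submodClosed V).

Record submodule := Submodule { submod_val :> V; _ : submod_val \in S }.

HB.instance Definition _ := [isSub of submodule for submod_val].
HB.instance Definition _ := [Choice of submodule by <:].
HB.instance Definition _ := [SubChoice_isSubLmodule of submodule by <:].

End Submodule.

Section QuotientModule.
Variables (R : pzRingType) (V : lmodType R) (S : submodClosed V).

(* Over a ring, a [submodClosed] predicate is closed under opposite, but the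
   library does not infer the [zmodClosed] structure that [Quotient.quot]
   needs. *)
Definition zmod_pred : {pred V} := S.

Lemma zmod_pred_closed : zmod_closed zmod_pred.
Proof.
split=> [|u v uS vS]; first exact: rpred0.
by rewrite -scaleN1r addrC; apply: (submodClosedP S).2.
Qed.
HB.instance Definition _ := GRing.isZmodClosed.Build V zmod_pred zmod_pred_closed.

Definition quotmod := Quotient.quot zmod_pred.
HB.instance Definition _ := GRing.Zmodule.on quotmod.

Definition quotmod_pi (v : V) : quotmod := \pi_(Quotient.quot zmod_pred) v.
Definition quotmod_repr (q : quotmod) : V := repr (q : Quotient.quot zmod_pred).

Lemma quotmod_reprK q : quotmod_pi (quotmod_repr q) = q.
Proof. exact: reprK. Qed.

Lemma quotmod_eqP u v : reflect (quotmod_pi u = quotmod_pi v) (u - v \in S).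
Proof.
have -> : (u - v \in S) = (u == v %[mod Quotient.quot zmod_pred]).
  exact: (Quotient.idealrBE zmod_pred u v).
exact: eqP.
Qed.

Lemma quotmod_piD u v : quotmod_pi (u + v) = quotmod_pi u + quotmod_pi v.
Proof. exact: (raddfD (\pi_(Quotient.quot zmod_pred))). Qed.

Definition quotmod_scale (a : R) (q : quotmod) : quotmod :=
  quotmod_pi (a *: quotmod_repr q).

Lemma quotmod_scale_pi a v : quotmod_scale a (quotmod_pi v) = quotmod_pi (a *: v).
Proof.
apply/quotmod_eqP; rewrite -scalerBr rpredZ //.
by apply/quotmod_eqP; rewrite quotmod_reprK.
Qed.

Lemma quotmod_scaleA a b q :
  quotmod_scale a (quotmod_scale b q) = quotmod_scale (a * b) q.
Proof. by rewrite -[q]quotmod_reprK !quotmod_scale_pi scalerA. Qed.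

Lemma quotmod_scale1 : left_id 1 quotmod_scale.
Proof. by move=> q; rewrite -[q]quotmod_reprK quotmod_scale_pi scale1r. Qed.

Lemma quotmod_scaleDr : right_distributive quotmod_scale +%R.
Proof.
move=> a p q; rewrite -[p]quotmod_reprK -[q]quotmod_reprK -quotmod_piD.
by rewrite !quotmod_scale_pi -quotmod_piD scalerDr.
Qed.

Lemma quotmod_scaleDl q : {morph quotmod_scale^~ q : a b / a + b}.
Proof.
by move=> a b; rewrite -[q]quotmod_reprK !quotmod_scale_pi -quotmod_piD scalerDl.
Qed.

HB.instance Definition _ := GRing.Zmodule_isLmodule.Build R quotmod
  quotmod_scaleA quotmod_scale1 quotmod_scaleDr quotmod_scaleDl.

Lemma quotmod_pi_is_linear : linear quotmod_pi.
Proof. by move=> a u v; rewrite quotmod_piD -quotmod_scale_pi. Qed.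

HB.instance Definition _ :=
  GRing.isLinear.Build R V quotmod *:%R quotmod_pi quotmod_pi_is_linear.

Lemma quotmod_pi_eq0 v : v \in S -> quotmod_pi v = 0.
Proof. by move=> vS; rewrite -(linear0 quotmod_pi); apply/quotmod_eqP; rewrite subr0. Qed.

Section Lift.
Variables (W : lmodType R) (f : {linear V -> W}).
Hypothesis f0 : forall v, v \in S -> f v = 0.

Definition quotmod_lift of (forall v, v \in S -> f v = 0) :=
  fun q : quotmod => f (quotmod_repr q).

Lemma quotmod_lift_pi v : quotmod_lift f0 (quotmod_pi v) = f v.
Proof.
apply/eqP; rewrite -subr_eq0 -linearB; apply/eqP/f0.
by apply/quotmod_eqP; rewrite quotmod_reprK.
Qed.

Lemma quotmod_lift_is_linear : linear (quotmod_lift f0).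
Proof.
move=> a p q; rewrite -[p]quotmod_reprK -[q]quotmod_reprK -linearP.
by rewrite !quotmod_lift_pi linearP.
Qed.

HB.instance Definition _ :=
  GRing.isLinear.Build R quotmod W *:%R (quotmod_lift f0) quotmod_lift_is_linear.

End Lift.
End QuotientModule.

Arguments quotmod_lift : simpl never.

Section KernelImage.
Variables (R : pzRingType) (U V : lmodType R) (f : {linear U -> V}).

Definition kernel : {pred U} := fun u => f u == 0.

Lemma kernel_submod_closed : submod_closed kernel.
Proof.
split=> [|a u v]; rewrite !unfold_in ?linear0 // => /eqP fu /eqP fv.
by rewrite linearP fu fv scaler0 addr0.
Qed.
HB.instance Definition _ :=
  GRing.isSubmodClosed.Build R U kernel kernel_submod_closed.

Definition image : {pred V} := fun v => `[< exists u, f u = v >].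

Lemma image_submod_closed : submod_closed image.
Proof.
split=> [|a u v]; first by apply/asboolP; exists 0; rewrite linear0.
move=> /asboolP[u' <-] /asboolP[v' <-]; apply/asboolP.
by exists (a *: u' + v'); rewrite linearP.
Qed.
HB.instance Definition _ :=
  GRing.isSubmodClosed.Build R V image image_submod_closed.

Lemma imageP v : reflect (exists u, f u = v) (v \in image).
Proof. exact: asboolP. Qed.

End KernelImage.

Section FreeModule.
Variables (R : comPzRingType) (B : finType).

Definition freemod := {ffun B -> R^o}.
HB.instance Definition _ := GRing.Lmodule.on freemod.

Definition gen (b : B) : freemod := [ffun b' => (b' == b)%:R].

Lemma freemod_sum (c : freemod) : c = \sum_b c b *: gen b.
Proof.
apply/ffunP => b; rewrite sum_ffunE (bigD1 b) //= big1 => [|b' b'b].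
  by rewrite !ffunE eqxx addr0 [RHS]mulr1.
by rewrite !ffunE eq_sym (negPf b'b) scaler0.
Qed.

Definition free_ext (V : lmodType R) (f : B -> V) (c : freemod) : V :=
  \sum_b c b *: f b.

Lemma free_ext_is_linear (V : lmodType R) (f : B -> V) : linear (free_ext f).
Proof.
move=> a c d; rewrite /free_ext scaler_sumr -big_split /=.
by apply: eq_bigr => b _; rewrite !ffunE scalerDl scalerA.
Qed.
HB.instance Definition _ (V : lmodType R) (f : B -> V) :=
  GRing.isLinear.Build R freemod V *:%R (free_ext f) (free_ext_is_linear f).

Lemma free_ext_gen (V : lmodType R) (f : B -> V) b : free_ext f (gen b) = f b.
Proof.
rewrite /free_ext (bigD1 b) //= big1 => [|b' b'b].
  by rewrite ffunE eqxx scale1r addr0.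
by rewrite ffunE (negPf b'b) scale0r.
Qed.

Lemma free_linear_eq (V : lmodType R) (f g : {linear freemod -> V}) :
  (forall b, f (gen b) = g (gen b)) -> f =1 g.
Proof.
move=> fg c; rewrite [c]freemod_sum !linear_sum.
by apply: eq_bigr => b _; rewrite !linearZ /= fg.
Qed.

Variable P : pred B.

Definition spanned : {pred freemod} :=
  fun c => `[< exists a : B -> R, c = \sum_(b | P b) a b *: gen b >].

Lemma spanned_submod_closed : submod_closed spanned.
Proof.
split=> [|k c d].
  by apply/asboolP; exists (fun=> 0); rewrite big1 // => b _; rewrite scale0r.
move=> /asboolP[a ->] /asboolP[b ->]; apply/asboolP.
exists (fun x => k * a x + b x); rewrite scaler_sumr -big_split /=.
by apply: eq_bigr => x _; rewrite scalerDl scalerA.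
Qed.
HB.instance Definition _ :=
  GRing.isSubmodClosed.Build R freemod spanned spanned_submod_closed.

Lemma gen_spanned b : P b -> gen b \in spanned.
Proof.
move=> Pb; apply/asboolP; exists (fun b' => (b' == b)%:R).
rewrite (bigD1 b) //= big1 => [|b' /andP[_ /negPf->]]; last by rewrite scale0r.
by rewrite eqxx scale1r addr0.
Qed.

Lemma spanned_linear (V : lmodType R) (S : submodClosed V)
    (f : {linear freemod -> V}) :
  (forall b, P b -> f (gen b) \in S) -> forall c, c \in spanned -> f c \in S.
Proof.
move=> fS c /asboolP[a ->]; rewrite linear_sum rpred_sum // => b Pb.
by rewrite linearZ rpredZ ?fS.
Qed.

End FreeModule.

Arguments gen R {B} b.
Arguments spanned R {B} P.

(* The direct sum of the modules [M 1], ..., [M n]. *)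
Fixpoint direct_sum (R : pzRingType) (M : nat -> lmodType R) (n : nat) :
    lmodType R :=
  if n is m.+1 then (direct_sum M m * M m.+1)%type else 'rV[R]_0.

Definition direct_power (R : pzRingType) (M : lmodType R) (k : nat) :
  lmodType R := {ffun 'I_k -> M}.

Definition lmod_isomorphic (R : pzRingType) (U V : lmodType R) : Prop :=
  exists f : {linear U -> V}, bijective f.

Record chain_complex (R : pzRingType) := ChainComplex {
  chains :> nat -> lmodType R;
  diff : forall n, {linear chains n.+1 -> chains n};
  diff_diff : forall n c, diff n (diff n.+1 c) = 0
}.

Section Homology.
Variable R : pzRingType.

Section At.
Variables (U V W : lmodType R) (f : {linear U -> V}) (g : {linear V -> W}).

Definition boundaries : {pred submodule (kernel g)} :=
  fun z => (z : V) \in image f.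

Lemma boundaries_submod_closed : submod_closed boundaries.
Proof.
have [im0 imP] := image_submod_closed f.
by split=> [|a u v uf vf]; [apply: im0 | apply: imP].
Qed.
HB.instance Definition _ :=
  GRing.isSubmodClosed.Build R (submodule (kernel g)) boundaries
    boundaries_submod_closed.

(* Meant for [g] vanishing on the image of [f]. *)
Definition homology_at : lmodType R := quotmod boundaries.

End At.

(* The differential leaving degree 0 is the zero map. *)
Definition homology (C : chain_complex R) (n : nat) : lmodType R :=
  match n with
  | 0 => homology_at (diff C 0) (\0 : {linear C 0%N -> 'rV[R]_0})
  | m.+1 => homology_at (diff C m.+1) (diff C m)
  end.

End Homology.

Section SubQuotientComplex.
Variables (R : pzRingType) (C : chain_complex R).
Variable S : forall n, submodClosed (C n).
Hypothesis diffS : forall n c, c \in S n.+1 -> diff C n c \in S n.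

Definition sub_diff n (c : submodule (S n.+1)) : submodule (S n) :=
  Submodule (diffS (valP c)).

Lemma sub_diff_is_linear n : linear (@sub_diff n).
Proof. by move=> a u v; apply: val_inj; rewrite /= linearP. Qed.
HB.instance Definition _ n :=
  GRing.isLinear.Build R (submodule (S n.+1)) (submodule (S n)) *:%R
    (@sub_diff n) (@sub_diff_is_linear n).

Lemma sub_diff_diff n c : @sub_diff n (@sub_diff n.+1 c) = 0.
Proof. by apply: val_inj; rewrite /= diff_diff. Qed.

Definition sub_complex : chain_complex R :=
  @ChainComplex R (fun n => submodule (S n) : lmodType R)
    (fun n => @sub_diff n) sub_diff_diff.

Lemma quot_diff_subproof n c :
  c \in S n.+1 -> (@quotmod_pi R (C n) (S n) \o diff C n) c = 0.
Proof. by move=> cS; rewrite /= quotmod_pi_eq0 ?diffS. Qed.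

Definition quot_diff n : {linear quotmod (S n.+1) -> quotmod (S n)} :=
  quotmod_lift (@quot_diff_subproof n).

Lemma quot_diff_diff n c : quot_diff n (quot_diff n.+1 c) = 0.
Proof.
by rewrite -[c]quotmod_reprK /= quotmod_lift_pi /= quotmod_lift_pi /= diff_diff linear0.
Qed.

Definition quot_complex : chain_complex R :=
  @ChainComplex R (fun n => quotmod (S n) : lmodType R)
    quot_diff quot_diff_diff.

End SubQuotientComplex.

Section Augmentation.
Variables (R : pzRingType) (C : chain_complex R).
Variable eps : {linear C 0%N -> R^o}.
Hypothesis eps_diff : forall c, eps (diff C 0 c) = 0.

(* Shifted by one: position 0 holds degree -1, position [n.+1] degree [n]. *)
Definition aug_chains (n : nat) : lmodType R :=
  if n is m.+1 then C m else R^o.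

Definition aug_diff (n : nat) : {linear aug_chains n.+1 -> aug_chains n} :=
  match n with 0 => eps | m.+1 => diff C m end.

Lemma aug_diff_diff n c : aug_diff n (aug_diff n.+1 c) = 0.
Proof. by case: n c => [|n] c; [apply: eps_diff | apply: diff_diff]. Qed.

Definition aug_complex : chain_complex R := ChainComplex aug_diff_diff.

Definition reduced_homology (k : int) : lmodType R :=
  match k with
  | Posz n => homology aug_complex n.+1
  | Negz 0 => homology aug_complex 0
  | Negz _.+1 => 'rV[R]_0
  end.

End Augmentation.

Definition spindle (X : Type) (op : X -> X -> X) : Prop :=
  (forall x, op x x = x) /\
  (forall x y z, op (op x y) z = op (op x z) (op y z)).

Section SpindleComplex.
Variables (R : comPzRingType) (X : finType) (op : X -> X -> X).

(* [x : word m] stands for the sequence (x_(m-1), ..., x_1, x_0). *)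
Definition word (m : nat) := {ffun 'I_m -> X}.

Definition face m (i : 'I_m.+1) (x : word m.+1) : word m :=
  [ffun j : 'I_m => if (j < i)%N then x (lift i j) else op (x (lift i j)) (x i)].

Definition degenerate m (x : word m) : bool :=
  [exists i : 'I_m, exists j : 'I_m, (j == i.+1 :> nat) && (x i == x j)].

Definition spindle_chains (n : nat) : lmodType R := freemod R (word n.+1).

Definition spindle_diff (n : nat) :
    {linear spindle_chains n.+1 -> spindle_chains n} :=
  free_ext (fun x : word n.+2 =>
    \sum_(i < n.+2) (-1) ^+ (n.+1 - i) *: gen R (face i x)).

Definition degenerate_chains (n : nat) : submodClosed (spindle_chains n) :=
  spanned R (@degenerate n.+1).

Hypothesis spX : spindle op.

Lemma spindle_diff_gen n (x : word n.+2) : spindle_diff n (gen R x) =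
  \sum_(i < n.+2) (-1) ^+ (n.+1 - i) *: gen R (face i x).
Proof. exact: free_ext_gen. Qed.

Lemma face_face m (x : word m.+2) (i j' : 'I_m.+2) (j i' : 'I_m.+1) :
  (j < i)%N -> i' = i.-1 :> nat -> j' = j :> nat ->
  face j (face i x) = face i' (face j' x).
Proof.
have [idem dist] := spX.
have eqx (k l : 'I_m.+2) : k = l :> nat -> x k = x l by move/val_inj->.
move=> ji i'E j'E; apply/ffunP => k; rewrite !ffunE /= !/bump.
have [kj|jk] := ltnP k j.
  have -> : (k < i')%N by lia.
  rewrite !add0n !ifT; try lia.
  by apply: eqx; rewrite /= /bump /=; lia.
rewrite !add1n ji; case: (ltnP k.+1 i) => ki.
  have -> : (k < i')%N by lia.
  rewrite ifN; last by lia.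
  by congr op; apply: eqx; rewrite /= /bump /=; lia.
have -> : (k < i')%N = false by lia.
rewrite !ifN; try lia.
by rewrite dist; congr (op (op _ _) (op _ _)); apply: eqx;
  rewrite /= /bump /=; lia.
Qed.

(* For [j < i], the summand [(i, j)] of an alternating double sum is matched
   with the summand [(j, i - 1)]. *)
Lemma alternating_sum0 (V : zmodType) m (G : 'I_m.+2 -> 'I_m.+1 -> V) :
  (forall (i j' : 'I_m.+2) (j i' : 'I_m.+1), (j < i)%N -> i' = i.-1 :> nat ->
     j' = j :> nat -> G i j = - G j' i') ->
  \sum_i \sum_j G i j = 0.
Proof.
move=> GN; pose T := ('I_m.+2 * 'I_m.+1)%type.
rewrite pair_big /= (bigID (fun p : T => (p.2 < p.1)%N)) /=.
pose h (p : T) : T := (lift ord0 p.2, inord p.1).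
pose h' (p : T) : T := (widen_ord (leqnSn _) p.2, inord p.1.-1).
rewrite (reindex_onto h h') /=; last first.
  move=> [i j] /= ji; rewrite /h /h' /=; congr pair; apply: val_inj => /=.
    by rewrite /bump /= inordK; have := ltn_ord i; lia.
  by rewrite inordK; have := ltn_ord j; lia.
rewrite [X in X + _](eq_big (fun p : T => ~~ (p.2 < p.1)%N)
    (fun p : T => - G p.1 p.2)) /=; first by rewrite sumrN addNr.
- move=> [i j] /=; rewrite /h /h' /= -leqNgt xpair_eqE.
  have jm := ltn_ord j; have im := ltn_ord i.
  case: (leqP i j) => ij.
    rewrite inordK; last by lia.
    rewrite /bump /= add1n ltnS ij /=; apply/andP.
    split; rewrite -val_eqE /= ?inordK; lia.
  apply/negP => /andP[ij'] /andP[/eqP/(congr1 val) /= Ei _].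
  have := leq_ord (inord i : 'I_m.+1); rewrite Ei => im'.
  by move: ij'; rewrite inordK ?ltnS // /bump /=; lia.
- move=> [i j] /andP[/= ji /eqP[]]; rewrite /h /h' /=.
  move=> /(congr1 val) /= Ei _; rewrite /= in Ei.
  apply: GN => //=; rewrite /bump /=.
Qed.

Lemma spindle_diff_diff n c : spindle_diff n (spindle_diff n.+1 c) = 0.
Proof.
pose z : {linear spindle_chains n.+2 -> spindle_chains n} := \0.
apply: (free_linear_eq (f := spindle_diff n \o spindle_diff n.+1) (g := z)).
move=> x; rewrite /= spindle_diff_gen linear_sum /=.
under eq_bigr => i _ do
  rewrite linearZ /= spindle_diff_gen scaler_sumr.
apply: alternating_sum0 => i j' j i' ji i'E j'E.
rewrite (face_face x ji i'E j'E) !scalerA -scaleNr -!exprD; congr (_ *: _).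
have im := ltn_ord i; have jm := ltn_ord j.
have -> : (n.+2 - i + (n.+1 - j) = (n.+2 - j' + (n.+1 - i')).-1)%N by lia.
have : (0 < n.+2 - j' + (n.+1 - i'))%N by lia.
by case: (_ + _)%N => // k _; rewrite exprS mulN1r opprK.
Qed.

Definition spindle_complex : chain_complex R :=
  ChainComplex spindle_diff_diff.

Lemma degenerate_diff n c :
  c \in degenerate_chains n.+1 -> spindle_diff n c \in degenerate_chains n.
Proof.
have [idem _] := spX.
apply: spanned_linear => x /existsP[k /existsP[l /andP[/eqP lE /eqP xkl]]].
have eqx (a b : 'I_n.+2) : a = b :> nat -> x a = x b by move/val_inj->.
have kl : l != k by rewrite -val_eqE /= lE; lia.
have kn := ltn_ord k; have ln := ltn_ord l.
rewrite spindle_diff_gen (bigD1 k) //= (bigD1 l) //= addrA.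
have -> : face k x = face l x.
  apply/ffunP => j; rewrite !ffunE.
  case: (ltnP j k) => jk.
    by rewrite ifT; [apply: eqx; rewrite /= /bump; lia | lia].
  case: (ltnP j l) => jl.
    have <- : x k = x (lift l j) by apply: eqx; rewrite /= /bump; lia.
    have -> : x (lift k j) = x k.
      by rewrite xkl; apply: eqx; rewrite /= /bump; lia.
    exact: idem.
  by rewrite xkl; congr op; apply: eqx; rewrite /= /bump; lia.
rewrite -scalerDl lE.
have -> : (n.+1 - k = (n.+1 - k.+1).+1)%N by lia.
rewrite exprS mulN1r addNr scale0r add0r rpred_sum // => i /andP[ik il].
rewrite rpredZ // gen_spanned //.
have ikn : i != k :> nat by rewrite val_eqE.
have iln : i != l :> nat by rewrite val_eqE.
have im := ltn_ord i.
have [ki|ki] := ltnP k i.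
  apply/existsP; exists (inord k); apply/existsP; exists (inord l).
  rewrite !ffunE !inordK; try lia.
  rewrite lE eqxx /= !ifT; try lia.
  apply/eqP; rewrite -[LHS]/(x _) -[RHS]/(x _).
  transitivity (x k); first by apply: eqx; rewrite /= /bump inordK; lia.
  by rewrite xkl; apply: eqx; rewrite /= /bump inordK; lia.
apply/existsP; exists (inord k.-1); apply/existsP; exists (inord l.-1).
rewrite !ffunE !inordK; try lia.
rewrite lE !ifN; try lia.
apply/andP; split; first by lia.
apply/eqP; congr op.
transitivity (x k); first by apply: eqx; rewrite /= /bump inordK; lia.
by rewrite xkl; apply: eqx; rewrite /= /bump inordK; lia.
Qed.

Definition degenerate_complex : chain_complex R :=
  sub_complex (C := spindle_complex) degenerate_diff.

Definition normalized_complex : chain_complex R :=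
  quot_complex (C := spindle_complex) degenerate_diff.

Lemma eps_subproof c :
  c \in degenerate_chains 0 -> free_ext (fun=> 1 : R^o) c = 0.
Proof.
move=> /asboolP[a ->]; rewrite big_pred0 ?linear0 // => x; apply/negbTE.
apply/existsP => -[i /existsP[j /andP[/eqP ji _]]].
by have := ltn_ord j; rewrite ji !ltnS ltn0.
Qed.

Definition eps : {linear normalized_complex 0%N -> R^o} :=
  quotmod_lift eps_subproof.

Lemma eps_diff c : eps (diff normalized_complex 0 c) = 0.
Proof.
rewrite -[c]quotmod_reprK /= quotmod_lift_pi /= quotmod_lift_pi /=.
pose z : {linear spindle_chains 1 -> R^o} := \0.
apply: (free_linear_eq (f := free_ext (fun=> 1 : R^o) \o spindle_diff 0)
  (g := z)) => x.
rewrite /= spindle_diff_gen linear_sum !big_ord_recl big_ord0 /=.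
by rewrite !linearZ /= !free_ext_gen expr1 expr0 scaleN1r scale1r addr0 addNr.
Qed.

Definition HD (n : nat) : lmodType R := homology degenerate_complex n.

Definition HNred (k : int) : lmodType R := reduced_homology eps_diff k.

End SpindleComplex.

(* The division is exact: see [multiplicityE]. *)
Definition multiplicity (q p : nat) : nat :=
  `|((q%:Z * (q%:Z ^+ p - (-1) ^+ p)) %/ (1 + q%:Z))%Z|%N.

Lemma multiplicityE (q p : nat) :
  (multiplicity q p)%:R =
    q%:R / (1 + q%:R) * (q%:R ^+ p - (-1) ^+ p) :> rat.
Proof.
have q1 : 1 + q%:R != 0 :> rat by rewrite nat1r pnatr_eq0.
pose t : int := \sum_(i < p) q%:Z ^+ (p.-1 - i) * (-1) ^+ i.
have tE : q%:Z ^+ p - (-1) ^+ p = (1 + q%:Z) * t.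
  by rewrite subrXX opprK addrC.
have mE : ((multiplicity q p)%:Z = q%:Z * t)%R.
  rewrite /multiplicity tE mulrCA mulKz; last by lia.
  apply: gez0_abs.
  have : 0 <= q%:Z * (q%:Z ^+ p - (-1) ^+ p).
    case: q {q1 t tE} => [|q]; first by rewrite mul0r.
    rewrite mulr_ge0 // subr_ge0 (@le_trans _ _ 1) //.
      by rewrite -signr_odd; case: odd.
    by rewrite exprn_ege1.
  by rewrite tE mulrCA pmulr_rge0 //; lia.
have := congr1 (fun x : int => x%:~R : rat) mE; rewrite intrM -pmulrn => ->.
have := congr1 (fun x : int => x%:~R : rat) tE.
rewrite intrM !rmorphD rmorphN !rmorphXn /= rmorphN1 => ->.
by rewrite mulrA divfK.
Qed.

(* Main.v *)
(* Write a chain as a combination of words x_n ... x_0, so that appending a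
   letter y on the right satisfies d(w y) = (d w) y +- w*y.  Two explicit maps
   drive the argument.
   - The substitution x_n (x_(n-1) - x_n) ... (x_0 - x_1) is a chain
     endomorphism which vanishes on degenerate words and is the identity modulo
     them; hence the augmented complex is C~ = N + D, with N its image and D the
     degenerate part.
   - Put T(x) = x x and T(b y) = T(b) y -+ y (T(b)*y).  The correction term
     cancels the action of y, so that u |-> u T(b) is a chain map from C~ to D.
     Sorting words by their rightmost repetition shows, by triangularity, that D
     is the direct sum of the images of these maps, b running over the words
     without repetition, of which there are q (q - 1)^l with l + 1 letters.
   With h_m = H_m(D) graded by word length this gives
   h_(m+2) = q (H_m(N) + h_m) + (q - 1) h_(m+1), and the multiplicities obey the
   same recursion. *)

Require Import Defs.
From HB Require Import structures.
From mathcomp Require Import all_boot all_order all_algebra.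
From mathcomp Require Import zify ring boolp functions.

Set Implicit Arguments.
Unset Strict Implicit.
Unset Printing Implicit Defensive.

Import GRing.Theory.
Local Open Scope ring_scope.

(* A word x_n ... x_0 is listed from the right, with head x_0, and a chain is a
   function on all lists; infinite formal sums are allowed, so that all degrees
   of the augmented complex live in one module. *)
Section Series.
Variables (R : comPzRingType) (X : finType) (op : X -> X -> X).
Hypothesis idem : forall x, op x x = x.

Definition series := seq X -> R^o.
HB.instance Definition _ := GRing.Lmodule.on series.

Implicit Types (c : series) (s : seq X) (x y z t : X).

Lemma seriesD c1 c2 s : (c1 + c2) s = c1 s + c2 s. Proof. by []. Qed.
Lemma seriesN c s : (- c) s = - c s. Proof. by []. Qed.
Lemma seriesZ a c s : (a *: c) s = a * c s. Proof. by []. Qed.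
Lemma series0 s : (0 : series) s = 0. Proof. by []. Qed.
Lemma series_sum I r (P : pred I) (F : I -> series) s :
  (\sum_(i <- r | P i) F i) s = \sum_(i <- r | P i) F i s.
Proof. by rewrite fct_sumE. Qed.

Definition seriesE := (seriesD, seriesN, seriesZ, series0, series_sum).

(** * Adding, removing and acting by the rightmost letter; the differential *)

Definition pop x c : series := fun s => c (x :: s).
Arguments pop : simpl never.

Lemma pop_is_linear x : linear (pop x). Proof. by []. Qed.
HB.instance Definition _ x :=
  GRing.isLinear.Build R series series *:%R (pop x) (pop_is_linear x).

Lemma series_eq c1 c2 :
  c1 [::] = c2 [::] -> (forall x, pop x c1 = pop x c2) -> c1 = c2.
Proof.
move=> e1 e2; apply/funext => -[|x s]; first exact: e1.
exact: (congr1 (fun f => f s) (e2 x)).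
Qed.

Definition push x c : series :=
  fun s => if s is y :: s' then if y == x then c s' else 0 else 0.

Lemma push_is_linear x : linear (push x).
Proof.
move=> a c1 c2; apply/funext => -[|y s]; rewrite !seriesE /=; first by ring.
by case: eqP => // _; ring.
Qed.
HB.instance Definition _ x :=
  GRing.isLinear.Build R series series *:%R (push x) (push_is_linear x).

Lemma push_nil x c : push x c [::] = 0. Proof. by []. Qed.

Lemma pop_push x y c : pop x (push y c) = if x == y then c else 0.
Proof. by apply/funext => s; rewrite /pop /=; case: eqP. Qed.

Lemma pop_sum_push x (F : X -> series) : pop x (\sum_y push y (F y)) = F x.
Proof.
rewrite linear_sum (bigD1 x) //= pop_push eqxx big1 ?addr0 // => y yx.
by rewrite pop_push eq_sym (negPf yx).
Qed.

Definition sgn c : series := fun s => (-1) ^+ size s * c s.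

Lemma sgn_is_linear : linear sgn.
Proof. by move=> a c1 c2; apply/funext => s; rewrite !seriesE /sgn !seriesE; ring. Qed.
HB.instance Definition _ := GRing.isLinear.Build R series series *:%R sgn sgn_is_linear.

Lemma sgn_nil c : sgn c [::] = c [::]. Proof. by rewrite /sgn expr0 mul1r. Qed.

Lemma pop_sgn x c : pop x (sgn c) = - sgn (pop x c).
Proof. by apply/funext => s; rewrite /pop /sgn !seriesE /= exprS -!mulrA mulN1r. Qed.

Lemma sgn_push x c : sgn (push x c) = - push x (sgn c).
Proof.
apply: series_eq => [|y]; first by rewrite sgn_nil push_nil seriesN push_nil oppr0.
by rewrite pop_sgn linearN /= !pop_push; case: eqP => // _; rewrite linear0.
Qed.

(** Pushforward along the letterwise map [op^~ y]. Since chains are functions, a coefficient of the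
    image is a sum over the preimages of its word. *)
Fixpoint act y c s : R^o :=
  if s is x :: s' then \sum_(z | op z y == x) act y (pop z c) s' else c [::].

Lemma act_is_linear y : linear (act y : series -> series).
Proof.
move=> a c1 c2; apply/funext => s; rewrite !seriesE.
elim: s c1 c2 => [|x s IHs] c1 c2 //=.
by under eq_bigr => z do rewrite IHs; rewrite big_split -mulr_sumr.
Qed.
HB.instance Definition _ y :=
  GRing.isLinear.Build R series series *:%R (act y : series -> series)
    (act_is_linear y).

Lemma act_nil y c : act y c [::] = c [::]. Proof. by []. Qed.

Lemma pop_act x y c : pop x (act y c) = \sum_(z | op z y == x) act y (pop z c).
Proof. by apply/funext => s; rewrite series_sum. Qed.

Lemma act_push x y c : act y (push x c) = push (op x y) (act y c).
Proof.
apply: series_eq => [|z] //; rewrite pop_act pop_push.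
have [->|zxy] := eqVneq z (op x y).
  rewrite (bigD1 x) //= pop_push eqxx big1 ?addr0 // => t /andP[_ tx].
  by rewrite pop_push (negPf tx) linear0.
rewrite big1 // => t txy; rewrite pop_push; case: eqP => [tx|_]; last exact: linear0.
by rewrite -tx (eqP txy) eqxx in zxy.
Qed.

(** On words, [erase] forgets the rightmost letter x_0, while [erase_act] is the face d_0: it
    removes x_0 and lets it act on the rest. *)
Definition erase c : series := \sum_y pop y c.
Definition erase_act c : series := \sum_y act y (pop y c).

Lemma erase_is_linear : linear erase.
Proof. by move=> a c1 c2; rewrite scaler_sumr -big_split; apply: eq_bigr. Qed.
HB.instance Definition _ :=
  GRing.isLinear.Build R series series *:%R erase erase_is_linear.

Lemma erase_act_is_linear : linear erase_act.
Proof.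
move=> a c1 c2; rewrite scaler_sumr -big_split.
by apply: eq_bigr => y _; rewrite /= !linearP.
Qed.
HB.instance Definition _ :=
  GRing.isLinear.Build R series series *:%R erase_act erase_act_is_linear.

Lemma erase_sum_push (F : X -> series) : erase (\sum_y push y (F y)) = \sum_y F y.
Proof. by apply: eq_bigr => y _; apply: pop_sum_push. Qed.

Lemma erase_actE y c : erase (act y c) = act y (erase c).
Proof.
rewrite /erase linear_sum.
under eq_bigr => x do rewrite pop_act.
by rewrite [RHS](partition_big (fun z => op z y) predT).
Qed.

Lemma erase_sgn c : erase (sgn c) = - sgn (erase c).
Proof. by rewrite /erase linear_sum -sumrN; apply: eq_bigr => y _; rewrite pop_sgn. Qed.

(** The rule d(w y) = (d w) y + (-1)^|w| w*y read on coefficients. On one-letter words it is the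
    augmentation, so [del] is the differential of the whole augmented complex. *)
Fixpoint del c s : R^o :=
  (if s is x :: s' then del (pop x c) s' else 0) + sgn (erase_act c) s.

Lemma del_is_linear : linear (del : series -> series).
Proof.
move=> a c1 c2; apply/funext => s; rewrite !seriesE.
elim: s c1 c2 => [|x s IHs] c1 c2 /=;
  rewrite !linearP ![(_ *: _ + _) _]seriesD ![(_ *: _) _]seriesZ /=; first by ring.
by rewrite IHs; ring.
Qed.
HB.instance Definition _ :=
  GRing.isLinear.Build R series series *:%R (del : series -> series) del_is_linear.

Lemma del_nil c : del c [::] = \sum_x c [:: x].
Proof. by rewrite /= add0r sgn_nil /erase_act series_sum. Qed.

Lemma pop_del x c : pop x (del c) = del (pop x c) - sgn (pop x (erase_act c)).
Proof. by rewrite -pop_sgn; apply/funext => s. Qed.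

Lemma del_push y c : del (push y c) = push y (del c) + sgn (act y c).
Proof.
have E : erase_act (push y c) = act y c.
  rewrite /erase_act (bigD1 y) //= pop_push eqxx big1 ?addr0 // => x xy.
  by rewrite pop_push (negPf xy) linear0.
apply: series_eq => [|x]; first by rewrite /= E.
rewrite pop_del E linearD /= !pop_push pop_sgn.
by case: eqP => // _; rewrite linear0 ?oppr0.
Qed.

Lemma erase_del c : erase (del c) = del (erase c) - sgn (erase (erase_act c)).
Proof.
rewrite /erase !linear_sum /= -big_split; apply: eq_bigr => x _; exact: pop_del.
Qed.

(* [norm] sends the word x_n ... x_0 to the expansion of
   x_n (x_(n-1) - x_n) ... (x_0 - x_1); [norm_step] peels off the last factor. *)
Definition norm_step x c : series := pop x c - push x (pop x (erase c)).

Lemma norm_step_is_linear x : linear (norm_step x).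
Proof.
by move=> a c1 c2; rewrite /norm_step !linearP /= scalerBr addrACA scalerN.
Qed.
HB.instance Definition _ x :=
  GRing.isLinear.Build R series series *:%R (norm_step x) (norm_step_is_linear x).

Fixpoint norm c s : R^o := if s is x :: s' then norm (norm_step x c) s' else c [::].

Lemma norm_is_linear : linear (norm : series -> series).
Proof.
move=> a c1 c2; apply/funext => s; rewrite !seriesE.
by elim: s c1 c2 => [|x s IHs] c1 c2 //=; rewrite linearP IHs.
Qed.
HB.instance Definition _ :=
  GRing.isLinear.Build R series series *:%R (norm : series -> series) norm_is_linear.

Lemma norm_nil c : norm c [::] = c [::]. Proof. by []. Qed.

Lemma pop_norm x c : pop x (norm c) = norm (norm_step x c).
Proof. by []. Qed.

Lemma norm_step_sgn x c : norm_step x (sgn c) = - sgn (norm_step x c).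
Proof.
rewrite /norm_step erase_sgn pop_sgn (linearN (pop x)) /= pop_sgn opprK.
by rewrite linearB /= sgn_push opprK opprD.
Qed.

Lemma norm_sgn c : norm (sgn c) = sgn (norm c).
Proof.
apply/funext => s; elim: s c => [|x s IHs] c; first by rewrite norm_nil !sgn_nil.
rewrite -[LHS]/(norm (norm_step x (sgn c)) s) -[RHS]/(pop x (sgn (norm c)) s).
by rewrite pop_sgn norm_step_sgn linearN /= !seriesN pop_norm IHs.
Qed.

Lemma norm_step_act x y c :
  norm_step x (act y c) = \sum_(z | op z y == x) act y (norm_step z c).
Proof.
rewrite /norm_step pop_act erase_actE pop_act linear_sum -sumrB.
by apply: eq_bigr => z /eqP zyx; rewrite linearB /= act_push zyx.
Qed.

Lemma norm_act y c : norm (act y c) = act y (norm c).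
Proof.
apply/funext => s; elim: s c => [|x s IHs] c; first by [].
rewrite -[LHS]/(norm (norm_step x (act y c)) s) -[RHS]/(pop x (act y (norm c)) s).
rewrite pop_act norm_step_act linear_sum !series_sum.
by apply: eq_bigr => z _; rewrite /= IHs.
Qed.

(** This is [pop_del] for [norm c] before [norm] is applied: [norm] commutes with [act], hence
    carries the sum on the right to [erase_act op (norm c)]. *)
Lemma norm_step_del x c :
  norm_step x (del c) =
    del (norm_step x c) - sgn (norm_step x (\sum_y act y (norm_step y c))).
Proof.
have -> : \sum_y act y (norm_step y c) =
    erase_act c - \sum_y push y (act y (pop y (erase c))).
  transitivity (\sum_y (act y (pop y c) - push (op y y) (act y (pop y (erase c))))).
    by apply: eq_bigr => y _; rewrite linearB /= act_push.
  (* Idempotence enters here: acting by [y] fixes the letter [y] just pushed. *)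
  by rewrite sumrB; congr (_ - _); apply: eq_bigr => y _; rewrite idem.
have NP : norm_step x (\sum_y push y (act y (pop y (erase c)))) =
    act x (pop x (erase c)) - push x (pop x (erase_act (erase c))).
  by rewrite /norm_step erase_sum_push pop_sum_push.
rewrite (linearB (norm_step x)) /= NP /norm_step pop_del erase_del.
rewrite (linearB (pop x)) /= pop_del pop_sgn.
rewrite (linearB del) /= del_push.
rewrite ?(linearB (push x)) /= ?(linearN (push x)) /= ?(linearB (push x)) /=.
rewrite !(linearB sgn) /= !sgn_push.
set a := del (pop x c); set b := sgn (pop x _); set e := push x (del _).
set f := push x (sgn _); set g := push x (sgn _); set h := sgn (act x _).
by apply/funext => s; rewrite !seriesE; ring.
Qed.

Lemma norm_del c : norm (del c) = del (norm c).
Proof.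
apply/funext => s; elim: s c => [|x s IHs] c.
  rewrite norm_nil !del_nil; apply: eq_bigr => y _.
  by rewrite /= /norm_step seriesD seriesN subr0.
rewrite -[LHS]/(norm (norm_step x (del c)) s) -[RHS]/(pop x (del (norm c)) s).
rewrite norm_step_del pop_del pop_norm (linearB norm) /= norm_sgn.
rewrite seriesD [RHS]seriesD IHs; congr (_ + _); rewrite !seriesN.
congr (- sgn _ s); rewrite -pop_norm linear_sum; congr (pop x _).
by apply: eq_bigr => y _; rewrite /= norm_act.
Qed.

(** * Nondegenerate words and the kernel of [norm] *)

Definition nondeg s := sorted (fun x y => x != y) s.

Lemma nondeg_cons2 x y s : nondeg [:: x, y & s] = (x != y) && nondeg (y :: s).
Proof. by []. Qed.

Lemma nondeg_cons x s : nondeg (x :: s) -> nondeg s.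
Proof. by case: s => [|y s] //; rewrite nondeg_cons2 => /andP[]. Qed.

Lemma norm_step_nondeg x c s :
  nondeg (x :: s) -> norm_step x c s = c (x :: s).
Proof.
move=> xs; rewrite /norm_step seriesD seriesN /pop.
case: s xs => [|y s]; first by rewrite push_nil subr0.
by rewrite nondeg_cons2 /= eq_sym => /andP[/negPf-> _]; rewrite subr0.
Qed.

Lemma norm_nondeg c s : nondeg s -> norm c s = c s.
Proof.
elim: s c => [|x s IHs] c // xs.
by rewrite -[LHS]/(norm (norm_step x c) s) IHs ?norm_step_nondeg // (nondeg_cons xs).
Qed.

(** Vanishing on nondegenerate words passes from [c] to [norm_step x c]: on a nondegenerate word
    starting with [x], the only term of [erase c] that survives is the one erasing another [x], and
    it cancels [pop x c]. *)
Lemma norm_degenerate c : (forall s, nondeg s -> c s = 0) -> norm c = 0.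
Proof.
move=> c0; apply/funext => s; rewrite series0.
elim: s c c0 => [|x s IHs] c c0; first by rewrite norm_nil c0.
rewrite -[LHS]/(norm (norm_step x c) s) IHs // => t tn.
case: t tn => [|y t] yt; first by rewrite norm_step_nondeg ?c0.
have [yx|yx] := eqVneq y x; last first.
  by rewrite norm_step_nondeg ?c0 // nondeg_cons2 eq_sym yx.
rewrite /norm_step seriesD seriesN /pop /= yx eqxx /erase series_sum (bigD1 x) //=.
rewrite big1 => [|z zx]; first by rewrite addr0 subrr.
by rewrite /pop c0 // nondeg_cons2 zx -yx.
Qed.

End Series.

(** * Grafting: the chain maps from the augmented complex to degenerate chains *)

Section Decomposition.
Variables (R : comPzRingType) (X : finType) (op : X -> X -> X).
Hypothesis spX : spindle op.

Notation series := (series R X).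
Notation act := (act op).
Notation del := (del op).
Implicit Types (c : series) (s b : seq X) (x y z t : X) (k l m n : nat).

(* Right multiplication by the chain T(b) described at the top, where the list
   [b] of size [n.+1] ends with the letter to be doubled; [n] is a separate
   argument because the recursive call is on [map]. *)
Fixpoint graft n b c : series :=
  match n, b with
  | n'.+1, y :: b' =>
      push y (graft n' b' c) - (-1) ^+ n' *: graft n' (map (op^~ y) b') (push y c)
  | _, x :: _ => push x (push x c)
  | _, [::] => 0
  end.

Lemma graftS n y b c : graft n.+1 (y :: b) c =
  push y (graft n b c) - (-1) ^+ n *: graft n (map (op^~ y) b) (push y c).
Proof. by []. Qed.

Lemma graft_is_linear n b : linear (graft n b).
Proof.
elim: n b => [|n IHn] [|x b] a c1 c2; rewrite /= ?scaler0 ?addr0 // !linearP //=.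
rewrite !IHn linearP /=; apply/funext => s; rewrite !seriesE; ring.
Qed.
HB.instance Definition _ n b :=
  GRing.isLinear.Build R series series *:%R (graft n b) (graft_is_linear n b).

(** T(b) is homogeneous with n + 2 letters, which gives the sign (-1)^n. *)
Lemma graft_sgn n b c : size b = n.+1 ->
  sgn (graft n b c) = (-1) ^+ n *: graft n b (sgn c).
Proof.
elim: n b c => [|n IHn] [|x b] c //= => [_|[bn]].
  by rewrite !sgn_push linearN opprK scale1r.
rewrite linearB linearZ /= sgn_push !IHn ?size_map //.
rewrite sgn_push linearN /= linearZ /= scalerN.
by apply/funext => s; rewrite !seriesE exprS; ring.
Qed.

Lemma act_graft n b y c : size b = n.+1 ->
  act y (graft n b c) = graft n (map (op^~ y) b) (act y c).
Proof.
elim: n b c => [|n IHn] [|x b] c //= => [_|[bn]]; first by rewrite !act_push.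
rewrite linearB linearZ /= act_push !IHn ?size_map // act_push.
(* Self-distributivity: acting by [x] and then [y] is acting by [y] and then [op x y]. *)
congr (_ - _ *: graft n _ _); rewrite -!map_comp; apply: eq_map => z /=.
by have [_ ->] := spX.
Qed.

(** For one letter, the two faces that remove one of the doubled letters agree by idempotence and
    have opposite signs. In the inductive step, the term where [y] acts on u T(b) cancels the term
    where [y] acts on u alone, coming from [push y c] in the correction. *)
Lemma del_graft n b c : size b = n.+1 -> del (graft n b c) = graft n b (del c).
Proof.
have [idem _] := spX.
elim: n b c => [|n IHn] [|x b] c //= => [_|[bn]].
  rewrite !del_push linearD /= act_push idem sgn_push -addrA.
  by rewrite addrN addr0.
rewrite linearB linearZ /= !del_push !IHn ?size_map // del_push act_graft //.
rewrite graft_sgn ?size_map // linearD /= scalerDr opprD.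
by apply/funext => s; rewrite !seriesE; ring.
Qed.

Lemma graft_nondeg n b c s : size b = n.+1 -> nondeg s -> graft n b c s = 0.
Proof.
elim: n b c s => [|n IHn] [|x b] c s //= => [_|[bn]] sn.
  case: s sn => [|y [|z s]] //=; first by rewrite if_same.
  case/andP=> yz _.
  by case: eqP => // yx; case: eqP => // zx; rewrite yx zx eqxx in yz.
rewrite seriesD seriesN seriesZ IHn ?size_map // mulr0 subr0.
by case: s sn => [|y s] // /nondeg_cons sn /=; rewrite IHn // if_same.
Qed.

(* Degree [m] of the complex shifted by [k]: words of length [m - k], hence 0
   if [m < k]. *)
Definition shifted k m c := forall s, (size s + k)%N != m -> c s = 0.

Lemma shifted_push k m x c : shifted k.+1 m c -> shifted k m (push x c).
Proof.
by move=> ck [|y s] //= sk; rewrite ck ?if_same // addnS.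
Qed.

Lemma shifted_pop k m x c : shifted k m c -> shifted k.+1 m (pop x c).
Proof. by move=> ck s sk; apply: ck; rewrite /= addSn -addnS. Qed.

Lemma shiftedP k m a c1 c2 :
  shifted k m c1 -> shifted k m c2 -> shifted k m (a *: c1 + c2).
Proof. by move=> e1 e2 s sk; rewrite !seriesE e1 // e2 // mulr0 addr0. Qed.

Lemma shifted0 k m : shifted k m 0. Proof. by []. Qed.

Lemma shiftedZ k m a c : shifted k m c -> shifted k m (a *: c).
Proof. by rewrite -[a *: c]addr0 => e; apply: shiftedP. Qed.

Lemma shiftedD k m c1 c2 :
  shifted k m c1 -> shifted k m c2 -> shifted k m (c1 + c2).
Proof. by move=> e1 e2; rewrite -[c1]scale1r; apply: shiftedP. Qed.

Lemma shiftedB k m c1 c2 :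
  shifted k m c1 -> shifted k m c2 -> shifted k m (c1 - c2).
Proof. by move=> e1 e2; rewrite addrC -scaleN1r; apply: shiftedP. Qed.

Lemma shifted_sum k m I r (P : pred I) (F : I -> series) :
  (forall i, P i -> shifted k m (F i)) -> shifted k m (\sum_(i <- r | P i) F i).
Proof. by move=> FP; apply: big_ind => //; apply: shiftedD. Qed.

Lemma shifted_act k m y c : shifted k m c -> shifted k m (act y c).
Proof.
move=> ck s; elim: s k c ck => [|x s IHs] k c ck sk; first by rewrite act_nil ck.
rewrite -[LHS]/(pop x (act y c) s) pop_act series_sum big1 // => z _.
by apply: (IHs k.+1); [apply: shifted_pop | rewrite addnS -addSn].
Qed.

Lemma shifted_sgn k m c : shifted k m c -> shifted k m (sgn c).
Proof. by move=> ck s sk; rewrite /sgn ck // mulr0. Qed.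

Lemma shifted_erase_act k m c : shifted k m c -> shifted k.+1 m (erase_act op c).
Proof.
by move=> ck; apply: shifted_sum => y _; apply/shifted_act/shifted_pop.
Qed.

Lemma shifted_del k m c : shifted k m c -> shifted k.+1 m (del c).
Proof.
move=> ck s; elim: s k c ck => [|x s IHs] k c ck sk.
  by rewrite /= add0r sgn_nil (shifted_erase_act ck).
rewrite -[LHS]/(pop x (del c) s) pop_del seriesD seriesN.
rewrite (IHs k.+1) ?add0r; [|exact: shifted_pop | by rewrite addnS -addSn].
rewrite (shifted_sgn (shifted_pop x (shifted_erase_act ck))) ?oppr0 //.
by rewrite addnS -addSn.
Qed.

Lemma shifted_norm k m c : shifted k m c -> shifted k m (norm c).
Proof.
move=> ck s; elim: s k c ck => [|x s IHs] k c ck sk; first by rewrite norm_nil ck.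
rewrite -[LHS]/(norm (norm_step x c) s) (IHs k.+1) //; last by rewrite addnS -addSn.
apply: shiftedB; first exact: shifted_pop.
apply/shifted_push/shifted_pop/shifted_sum => y _; exact: shifted_pop.
Qed.

Lemma shifted_graft n b k m c :
  shifted (k + n.+2) m c -> shifted k m (graft n b c).
Proof.
elim: n b k c => [|n IHn] [|x b] k c ck /=; try exact: shifted0.
- by do 2 apply: shifted_push; move: ck; rewrite addn2.
apply: shiftedB; first by apply/shifted_push/IHn; rewrite addSnnS.
by apply/shiftedZ/IHn/shifted_push; rewrite -addnS.
Qed.

(* Reads off the coefficients of the words starting, from the right, with [b]
   followed by its last letter once more. *)
Fixpoint prune b c : series :=
  if b is x :: b' then prune b' (if b' is [::] then pop x (pop x c) else pop x c)
  else c.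

Lemma prune1 x c : prune [:: x] c = pop x (pop x c). Proof. by []. Qed.

Lemma prune_cons x b c :
  prune (x :: b) c = prune b (if b is [::] then pop x (pop x c) else pop x c).
Proof. by []. Qed.

Lemma prune_cons2 x y b c : prune [:: x, y & b] c = prune (y :: b) (pop x c).
Proof. by []. Qed.

Lemma prune_is_linear b : linear (prune b).
Proof.
by elim: b => [|x b IHb] a c1 c2 //=; case: b IHb => [|y b] IHb; rewrite !linearP ?IHb.
Qed.
HB.instance Definition _ b :=
  GRing.isLinear.Build R series series *:%R (prune b) (prune_is_linear b).

Arguments prune : simpl never.

Lemma shifted_prune b k m c : (0 < size b)%N ->
  shifted k m c -> shifted (k + (size b).+1) m (prune b c).
Proof.
elim: b k c => [|x [|y b] IHb] k c // _ ck.
  by rewrite addn2; apply/shifted_pop/shifted_pop.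
rewrite prune_cons2 /= -addSnnS; apply: IHb => //; exact: shifted_pop.
Qed.

Lemma prune_graft n n' b b' c :
  (n <= n')%N -> size b = n.+1 -> size b' = n'.+1 -> nondeg b' ->
  prune b' (graft n b c) = if b == b' then c else 0.
Proof.
elim: n n' b b' c => [|n IHn] n' [|x b] // [|x' b'] // c nn' [bn] [bn'] b'n.
  case: b bn => // _; case: b' bn' b'n => [|y' b'] _ b'n.
    rewrite !prune1 [graft _ _ _]/= pop_push eqseq_cons andbT eq_sym.
    by case: eqP => [<-|_]; rewrite ?pop_push ?eqxx ?linear0.
  rewrite prune_cons2 [graft _ _ _]/= pop_push eqseq_cons andbF.
  case: eqP => [xx'|_]; last by rewrite linear0.
  (* The grafted word repeats [x] at once, whereas [b'] continues with a letter other than [x]. *)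
  move: b'n; rewrite nondeg_cons2 xx' => /andP[/negPf y'x _].
  by rewrite prune_cons pop_push eq_sym y'x; case: (b') => [|? ?]; rewrite !linear0.
case: b' bn' b'n => [|y' b'] bn' b'n; first by case: n' nn' bn'.
rewrite graftS linearB linearZ /=.
rewrite [X in _ - _ *: X](IHn n') ?size_map //=; last 2 first.
- exact: ltnW.
- by rewrite -bn'.
rewrite ifN ?scaler0 ?subr0; last first.
  apply/eqP => /(congr1 size); rewrite size_map bn -[RHS]/(size (y' :: b')).+1 bn'; lia.
rewrite prune_cons2 pop_push eqseq_cons [x == _]eq_sym.
case: eqP => [_|_] /=; last by rewrite linear0.
case: n' nn' bn' => // n' nn' bn'; apply: (IHn n') => //.
exact: nondeg_cons b'n.
Qed.

(** The word is cut at its rightmost repetition: [y :: b] runs up to the first of the two equal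
    letters, and [u] is what follows the second. *)
Lemma degenerate_prune y s : ~~ nondeg (y :: s) ->
  exists b u, nondeg (y :: b) /\ forall c, c (y :: s) = prune (y :: b) c u.
Proof.
elim: s y => [|z s IHs] y //; rewrite nondeg_cons2 negb_and negbK.
case: eqVneq => [<- _|yz /IHs[b [u [bn bE]]]]; first by exists [::], s.
exists (z :: b), u; split; first by rewrite nondeg_cons2 yz.
by move=> c; rewrite prune_cons2 -bE.
Qed.

(** * Degenerate chains as sums of grafts *)

Definition degenerates m c := shifted 0 m c /\ forall s, nondeg s -> c s = 0.

(** A filtration of the degenerate chains of length [m]: only words [b] of at most [l] letters are
    grafted. As T(b) has [(size b).+1] letters, its coefficient [f b] is shifted by that amount. *)
Definition grafts l m c := exists f : seq X -> series,
  (forall b, shifted (size b).+1 m (f b)) /\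
  c = \sum_(i < l) \sum_(b : i.+1.-tuple X | nondeg b) graft i b (f b).

Lemma grafts_degenerates l m c : grafts l m c -> degenerates m c.
Proof.
move=> [f [fm ->]]; split=> [|s sn].
  apply: shifted_sum => i _; apply: shifted_sum => b _; apply: shifted_graft.
  by rewrite add0n -{1}(size_tuple b).
rewrite series_sum big1 // => i _; rewrite series_sum big1 // => b _.
by rewrite graft_nondeg ?size_tuple.
Qed.

Lemma grafts_del l m c : grafts l m.+1 c -> grafts l m (del c).
Proof.
move=> [f [fm ->]]; exists (fun b => del (f b)); split=> [b s sb|].
  by apply: shifted_del (fm b) _ _; rewrite addnS eqSS.
rewrite linear_sum; apply: eq_bigr => i _; rewrite linear_sum.
by apply: eq_bigr => b _; rewrite /= del_graft ?size_tuple.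
Qed.

(** By triangularity, pruning along a word of the maximal length sees only the graft along that very
    word. *)
Lemma prune_grafts l (b : l.+1.-tuple X) (f : seq X -> series) : nondeg b ->
  prune b (\sum_(i < l.+1) \sum_(b : i.+1.-tuple X | nondeg b) graft i b (f b)) =
  f b.
Proof.
move=> bn; rewrite linear_sum big_ord_recr /= big1 => [|i _].
  rewrite add0r linear_sum (bigD1 b) //= (prune_graft _ (leqnn l)) ?size_tuple //.
  rewrite eqxx big1 ?addr0 // => b' /andP[_ b'b].
  by rewrite (prune_graft _ (leqnn l)) ?size_tuple // ifN.
rewrite linear_sum big1 // => b' _.
rewrite /= (prune_graft _ (ltnW (ltn_ord i))) ?size_tuple // ifN //.
apply/eqP => /(congr1 size); rewrite !size_tuple => -[E].
by have := ltn_ord i; rewrite E ltnn.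
Qed.

(** Removes the layer of grafts along words of [l.+1] letters, the top one in [grafts op l.+1]. *)
Definition unpruned l c : series :=
  c - \sum_(b : l.+1.-tuple X | nondeg b) graft l b (prune b c).

Lemma unpruned_grafts l m c : grafts l.+1 m c -> grafts l m (unpruned l c).
Proof.
move=> [f [fm cE]]; exists f; split=> //.
rewrite /unpruned cE; under [X in _ - X]eq_bigr => b bn do rewrite prune_grafts //.
by rewrite big_ord_recr addrK.
Qed.

(** Here [l] bounds the length of the words [b] with [prune b c] nonzero. Removing the layer of
    length [l.+1] lowers the bound by one. At bound 0 the chain is zero, because [degenerate_prune]
    finds each degenerate coefficient in some [prune b c]. *)
Lemma degenerates_grafts_ind l m c : degenerates m c ->
  (forall b, (l < size b)%N -> nondeg b -> prune b c = 0) -> grafts l m c.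
Proof.
elim: l c => [|l IHl] c [cm cn] c0.
  exists (fun=> 0); split=> [b s|] //; rewrite big_ord0.
  apply/funext => s; have [/cn //|] := boolP (nondeg s).
  case: s => // y s /degenerate_prune[b [u [bn ->]]].
  by rewrite c0.
have [||f [fm E]] := IHl (unpruned l c).
- split=> [|s sn].
    apply: shiftedB => //; apply: shifted_sum => b _; apply: shifted_graft.
    by rewrite add0n -{1}(size_tuple b) -[_.+1]add0n; apply: shifted_prune;
      rewrite ?size_tuple.
  rewrite /unpruned seriesD seriesN cn // series_sum big1 ?subr0 // => b _.
  by rewrite graft_nondeg ?size_tuple.
- move=> b lb bn; rewrite /unpruned linearB linear_sum /=.
  have PG (b' : l.+1.-tuple X) : prune b (graft l b' (prune b' c)) =
      if b' == b :> seq X then prune b' c else 0.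
    case: b lb bn => [|x b] // lb bn.
    by rewrite (prune_graft (n' := size b)) ?size_tuple.
  under eq_bigr => b' _ do rewrite PG.
  have [bl|bl] := eqVneq (size b) l.+1.
    have bl' : size b == l.+1 by rewrite bl.
    rewrite (bigD1 (Tuple bl')) //= eqxx big1 ?addr0 ?subrr // => b' /andP[_ b'b].
    by rewrite ifN.
  rewrite c0 // ?big1 ?subr0 // => [b' _|]; last by rewrite ltn_neqAle eq_sym bl.
  by rewrite ifN //; apply: contraNneq bl => <-; rewrite size_tuple.
exists (fun b => if size b == l.+1 then prune b c else f b); split=> [b|].
  case: eqP => // bl; rewrite -[_.+1]add0n; apply: shifted_prune => //.
  by rewrite bl.
rewrite big_ord_recr /=.
transitivity (unpruned l c + \sum_(b : l.+1.-tuple X | nondeg b) graft l b (prune b c)).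
  by rewrite subrK.
rewrite E; congr (_ + _); last by apply: eq_bigr => b _; rewrite size_tuple eqxx.
apply: eq_bigr => i _; apply: eq_bigr => b _; rewrite size_tuple ifN // eqSS.
by have := ltn_ord i; rewrite ltn_neqAle => /andP[].
Qed.

(** A graft along [b] contributes [(size b).+1] letters, too many for words of length [m] once
    [size b] exceeds [l]. *)
Lemma degenerates_grafts l m c : (m <= l.+1)%N -> degenerates m c -> grafts l m c.
Proof.
move=> ml cm; apply: degenerates_grafts_ind => // b lb bn.
apply/funext => s; have b0 : (0 < size b)%N by case: (b) lb.
apply: (shifted_prune b0 cm.1); lia.
Qed.

End Decomposition.

(** * The first isomorphism theorem *)

Section FirstIsomorphism.
Variables (R : pzRingType) (U W : lmodType R) (S : submodClosed U).

Lemma quotmod_iso (F : U -> W) : linear F ->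
  (forall u, F u = 0 <-> u \in S) -> (forall w, exists u, F u = w) ->
  lmod_isomorphic (quotmod S) W.
Proof.
move=> Flin FS Fsurj.
pose FL := GRing.isLinear.Build R U W *:%R F Flin.
pose F' : {linear U -> W} := HB.pack F FL.
have F0 v : v \in S -> F' v = 0 by move/FS.
have [G GK] := choice Fsurj.
exists (quotmod_lift F0); exists (fun w => quotmod_pi S (G w)) => [q|w]; last first.
  by rewrite /= quotmod_lift_pi; apply: GK.
rewrite -[q]quotmod_reprK /= quotmod_lift_pi; apply/quotmod_eqP/FS.
by rewrite -[F _]/(F' _) linearB /= GK subrr.
Qed.

End FirstIsomorphism.

(** * Homology of graded subcomplexes of one module with an endomorphism *)

Section Subcomplexes.
Variables (R : pzRingType) (V : lmodType R) (d : {linear V -> V}).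

(** The degrees are predicates on a single ambient module with a single [d], so that different
    degrees and different complexes can be compared without transport. *)
Record subcomplex := Subcomplex {
  part :> nat -> V -> Prop;
  part0 m : part m 0;
  partP m a u v : part m u -> part m v -> part m (a *: u + v);
  part_d m u : part m.+1 u -> part m (d u)
}.

Implicit Types (S : subcomplex) (m : nat).

Definition cycle S m v := S m v /\ d v = 0.
Definition boundary S m v := exists2 w, S m.+1 w & d w = v.

Definition cycle_pred S m : {pred V} := fun v => `[< cycle S m v >].

Lemma cycle_pred_closed S m : submod_closed (cycle_pred S m).
Proof.
split=> [|a u v]; first by apply/asboolP; split; [apply: part0 | apply: linear0].
move=> /asboolP[Su du] /asboolP[Sv dv]; apply/asboolP; split; first exact: partP.
by rewrite linearP du dv scaler0 addr0.
Qed.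
HB.instance Definition _ S m :=
  GRing.isSubmodClosed.Build R V (cycle_pred S m) (cycle_pred_closed S m).

Definition boundary_pred S m : {pred submodule (cycle_pred S m)} :=
  fun z => `[< boundary S m (submod_val z) >].
Arguments boundary_pred : clear implicits.

Lemma boundary_pred_closed S m : submod_closed (boundary_pred S m).
Proof.
split=> [|a u v].
  by apply/asboolP; exists 0; [apply: part0 | apply: linear0].
move=> /asboolP[u' Su uE] /asboolP[v' Sv vE]; apply/asboolP.
by exists (a *: u' + v'); [apply: partP | rewrite linearP uE vE].
Qed.
HB.instance Definition _ S m :=
  GRing.isSubmodClosed.Build R (submodule (cycle_pred S m)) (boundary_pred S m)
    (boundary_pred_closed S m).

Definition subhomology S m : lmodType R := quotmod (boundary_pred S m).
Local Notation H := subhomology.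

(** [F] is a bare function, linear on cycles only, because it will be built from [hclass], whose
    linearity is available only there. *)
Lemma H_iso S m (W : lmodType R) (F : V -> W) :
  (forall a u v, cycle S m u -> cycle S m v -> F (a *: u + v) = a *: F u + F v) ->
  (forall z, cycle S m z -> F z = 0 <-> boundary S m z) ->
  (forall w, exists2 z, cycle S m z & F z = w) ->
  lmod_isomorphic (H S m) W.
Proof.
move=> Flin F0 Fsurj.
have Z (z : submodule (cycle_pred S m)) : cycle S m (submod_val z).
  exact/asboolP/(valP z).
apply: (quotmod_iso (F := fun z : submodule (cycle_pred S m) => F (submod_val z))).
- by move=> a u v; rewrite -Flin.
- move=> z; rewrite F0 //.
  by split=> [?|/asboolP]; [apply/asboolP|].
- move=> w; have [z Sz <-] := Fsurj w; have zS : z \in cycle_pred S m by apply/asboolP.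
  by exists (Submodule zS).
Qed.

(* Junk value 0 on non-cycles. *)
Definition hclass S m (v : V) : H S m :=
  if insub v is Some z then quotmod_pi (boundary_pred S m) z else 0.

Lemma hclassE S m (z : submodule (cycle_pred S m)) :
  hclass S m (submod_val z) = quotmod_pi (boundary_pred S m) z.
Proof. by rewrite /hclass valK. Qed.

Lemma cycle_val S m v : cycle S m v ->
  exists z : submodule (cycle_pred S m), v = submod_val z.
Proof. by move=> /asboolP Sv; exists (Submodule (Sv : v \in cycle_pred S m)). Qed.

Lemma hclassP S m a u v : cycle S m u -> cycle S m v ->
  hclass S m (a *: u + v) = a *: hclass S m u + hclass S m v.
Proof.
move=> /cycle_val[u' ->] /cycle_val[v' ->].
by rewrite !hclassE -linearP /= -hclassE.
Qed.

Lemma hclass_eq0 S m v : cycle S m v -> hclass S m v = 0 <-> boundary S m v.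
Proof.
move=> /cycle_val[z ->]; rewrite hclassE; split=> [|Sz].
  rewrite -(linear0 (quotmod_pi (boundary_pred S m))) => /quotmod_eqP.
  by rewrite subr0 => /asboolP.
by apply: quotmod_pi_eq0; apply/asboolP.
Qed.

Lemma hclass_surj S m h : exists2 z, cycle S m z & hclass S m z = h.
Proof.
exists (submod_val (quotmod_repr h)); first exact/asboolP/(valP (quotmod_repr h)).
by rewrite hclassE quotmod_reprK.
Qed.

(** With [d] common to both, homology in degree [m] sees only the parts [m] and [m.+1]. *)
Lemma H_ext S S' m m' : (forall v, S m v <-> S' m' v) ->
  (forall v, S m.+1 v <-> S' m'.+1 v) ->
  lmod_isomorphic (H S m) (H S' m').
Proof.
move=> SS' SS1; have ZE z : cycle S m z <-> cycle S' m' z by rewrite /cycle SS'.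
apply: (H_iso (F := hclass S' m')) => [a u v /ZE ? /ZE ?|z /ZE Sz|h].
- exact: hclassP.
- by rewrite hclass_eq0 //; split=> -[w /SS1]; exists w.
- by have [z /ZE ? <-] := hclass_surj h; exists z.
Qed.

Lemma H_trivial S m : (forall v, S m v -> v = 0) ->
  lmod_isomorphic (H S m) 'rV[R]_0.
Proof.
move=> S0; apply: (H_iso (F := fun=> 0)) => [a u v _ _|z [/S0-> _]|w].
- by rewrite scaler0 addr0.
- by split=> // _; exists 0; [apply: part0 | apply: linear0].
- by exists 0; [split; [apply: part0 | apply: linear0] | apply/rowP; case].
Qed.

Lemma homology_at_iso (A B C W : lmodType R) (f : {linear A -> B})
    (g : {linear B -> C}) (F : B -> W) :
  (forall a u v, g u = 0 -> g v = 0 -> F (a *: u + v) = a *: F u + F v) ->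
  (forall z, g z = 0 -> F z = 0 <-> exists u, f u = z) ->
  (forall w, exists2 z, g z = 0 & F z = w) ->
  lmod_isomorphic (homology_at f g) W.
Proof.
move=> Flin F0 Fsurj.
have K (z : submodule (kernel g)) : g (submod_val z) = 0 by apply/eqP/(valP z).
apply: (quotmod_iso (F := fun z : submodule (kernel g) => F (submod_val z))).
- by move=> a u v; rewrite -Flin.
- by move=> z; rewrite F0 //; split=> [?|/Defs.imageP]; [apply/Defs.imageP|].
- move=> w; have [z /eqP gz <-] := Fsurj w.
  by exists (Submodule (gz : z \in kernel g)).
Qed.

(* [e] is the degree shift between [C] and the word-length grading of [S]. *)
Lemma homology_H (C : chain_complex R) S e (phi : forall n, {linear C n -> V}) n :
  (forall n, injective (phi n)) ->
  (forall n v, S (e + n)%N v <-> exists c, phi n c = v) ->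
  (forall n c, phi n (diff C n c) = d (phi n.+1 c)) ->
  (forall c, d (phi 0%N c) = 0) ->
  lmod_isomorphic (homology C n) (H S (e + n)%N).
Proof.
move=> phiI phiS phid d0.
have phi0 k c : phi k c = 0 -> c = 0 by rewrite -(linear0 (phi k)) => /phiI.
(* Both cases of [homology] at once: [g] is the outgoing map, which is zero in degree 0 and there
   corresponds to the hypothesis on [phi 0]. *)
have aux (W : lmodType R) (g : {linear C n -> W}) :
    (forall c, g c = 0 <-> d (phi n c) = 0) ->
    lmod_isomorphic (homology_at (diff C n) g) (H S (e + n)%N).
  move=> gE; have Z c : g c = 0 -> cycle S (e + n)%N (phi n c).
    by move=> /gE dc; split=> //; apply/phiS; exists c.
  apply: (homology_at_iso (F := fun c => hclass S (e + n)%N (phi n c))).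
  - by move=> a u v /Z ? /Z ?; rewrite linearP hclassP.
  - move=> z /Z Sz; rewrite hclass_eq0 //; split=> [[w]|[u <-]].
      by rewrite -addnS => /phiS[u <-]; rewrite -phid => /phiI; exists u.
    by exists (phi n.+1 u); [rewrite -addnS; apply/phiS; exists u | rewrite phid].
  - move=> h; have [z [/phiS[c <-] dc] <-] := hclass_surj h.
    by exists c => //; apply/gE.
case: n aux => [|n] aux; apply: aux => c; first by split.
by rewrite -phid; split=> [->|/phi0]; rewrite ?linear0.
Qed.

End Subcomplexes.

(** * The complexes of words and their splittings *)

Section WordHomology.
Variables (R : comPzRingType) (X : finType) (op : X -> X -> X).
Hypothesis spX : spindle op.

Notation series := (series R X).
Notation del := (del op : {linear series -> series}).
Implicit Types (c : series) (k l m : nat).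

Notation subcomplex := (subcomplex del).
Local Notation H := subhomology.

Definition shifted_complex k : subcomplex.
Proof.
apply: (@Subcomplex R series del (fun m c => shifted k m c)).
- by move=> m; apply: shifted0.
- by move=> m a u v; apply: shiftedP.
- move=> m u um s sk; rewrite /= (shifted_del op (um : shifted k m.+1 u)) //.
  by rewrite addnS eqSS.
Defined.

Definition degenerate_subcomplex : subcomplex.
Proof.
apply: (@Subcomplex R series del (fun m c => degenerates m c)).
- by move=> m; split.
- move=> m a u v [um un] [vm vn]; split; first exact: shiftedP.
  by move=> s sn; rewrite !seriesE un // vn // mulr0 addr0.
(* Stability under [del] is inherited from grafts, with which [del] commutes. *)
- move=> m u /(degenerates_grafts op (leqnn _)) ul.
  exact: grafts_degenerates (grafts_del spX ul).
Defined.

(** The image of [norm]: a copy of the augmented normalized complex, complementary to the degenerate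
    chains. Part [m] has words of [m] letters, thus degree [m] minus one. *)
Definition norm_subcomplex : subcomplex.
Proof.
apply: (@Subcomplex R series del (fun m c => exists2 u, shifted 0 m u & norm u = c)).
- by move=> m; exists 0; [apply: shifted0 | apply: linear0].
- move=> m a _ _ [u um <-] [v vm <-]; exists (a *: u + v); first exact: shiftedP.
  by rewrite linearP.
- move=> m _ [u um <-]; exists (del u); last by rewrite norm_del //; have [] := spX.
  by move=> s sk; rewrite /= (shifted_del op um) // addnS eqSS.
Defined.

Definition graft_subcomplex l : subcomplex.
Proof.
apply: (@Subcomplex R series del (fun m c => grafts op l m c)).
- move=> m; exists (fun=> 0); split=> [b|]; first exact: shifted0.
  by rewrite big1 // => i _; rewrite big1 // => b _; rewrite linear0.
- move=> m a _ _ [f [fm ->]] [g [gm ->]]; exists (fun b => a *: f b + g b).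
  split=> [b|]; first exact: shiftedP.
  rewrite scaler_sumr -big_split; apply: eq_bigr => i _.
  by rewrite scaler_sumr -big_split; apply: eq_bigr => b _; rewrite /= linearP.
- by move=> m u; apply: grafts_del.
Defined.

Local Notation C := shifted_complex.
Local Notation D := degenerate_subcomplex.
Local Notation N := norm_subcomplex.
Local Notation G := graft_subcomplex.

Lemma norm_sub_degenerates m c : shifted 0 m c -> degenerates m (c - norm c).
Proof.
move=> cm; split=> [|s sn]; first by apply: shiftedB => //; apply: shifted_norm.
by rewrite seriesD seriesN norm_nondeg // subrr.
Qed.

Lemma norm_degenerates m c : degenerates m c -> norm c = 0.
Proof. by case=> _; apply: norm_degenerate. Qed.

Lemma norm_idem m c : shifted 0 m c -> norm (norm c) = norm c.
Proof.
move/norm_sub_degenerates/norm_degenerates; rewrite linearB /=.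
by move/eqP; rewrite subr_eq0 => /eqP.
Qed.

Let delC c : norm (del c) = del (norm c).
Proof. by rewrite norm_del //; case: spX. Qed.

(** [norm] is an idempotent chain map whose kernel on chains of a given length is the degenerate
    part, so [z] splits as [norm z] plus [z - norm z]. *)
Lemma H_split m : lmod_isomorphic (H (C 0) m) (H N m * H D m)%type.
Proof.
have ZN z : cycle (C 0) m z -> cycle N m (norm z).
  by case=> zm dz; split; [exists z | rewrite -delC dz linear0].
have ZD z : cycle (C 0) m z -> cycle D m (z - norm z).
  case=> zm dz; split; first exact: norm_sub_degenerates.
  by rewrite linearB /= -delC /= !dz linear0 subrr.
apply: (H_iso (F := fun z => (hclass N m (norm z), hclass D m (z - norm z)))).
- move=> a u v Zu Zv; congr pair.
    by rewrite linearP /= hclassP //; apply: ZN.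
  by rewrite linearP /= opprD addrACA -scalerBr hclassP //; apply: ZD.
- move=> z Zz; split=> [[/hclass_eq0 BN /hclass_eq0 BD]|[w wm wz]].
    have [|_ [w wm <-] wz] := BN; first exact: ZN.
    have [|u [um un] uz] := BD; first exact: ZD.
    exists (norm w + u).
      by apply: shiftedD => //; apply: shifted_norm.
    by rewrite linearD /= wz uz addrC subrK.
  congr pair; apply/hclass_eq0; [exact: ZN| |exact: ZD|].
    by exists (norm w); [exists w | rewrite -delC wz].
  exists (w - norm w); first exact: norm_sub_degenerates.
  by rewrite linearB /= -delC /= !wz.
- move=> [h1 h2].
  have [_ [[u um <-] du] <-] := hclass_surj h1.
  have [v [vm dv] <-] := hclass_surj h2.
  have nv := norm_degenerates vm.
  exists (norm u + v).
    split; last by rewrite linearD /= du dv addr0.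
    by apply: shiftedD; [apply: shifted_norm | case: vm].
  by rewrite linearD /= nv addr0 (norm_idem um) addrC addKr.
Qed.

Lemma H_shifted k m : lmod_isomorphic (H (C k.+1) m.+1) (H (C k) m).
Proof. by apply: H_ext => v; split=> vm s sk; apply: vm; rewrite addnS eqSS in sk *. Qed.

Lemma H_graft0 m : lmod_isomorphic (H (G 0) m) 'rV[R]_0.
Proof. by apply: H_trivial => v [f [_ ->]]; rewrite big_ord0. Qed.

(** Level [m] of the filtration already contains all degenerate chains of lengths [m] and [m.+1],
    the two lengths that matter for [H _ m]. *)
Lemma H_graft_degenerate m : lmod_isomorphic (H D m) (H (G m) m).
Proof.
by apply: H_ext => v; split; (exact: degenerates_grafts || exact: grafts_degenerates).
Qed.

(** * Homology of the filtration by grafts, one layer at a time *)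

Definition nondeg_word l := {b : l.+1.-tuple X | nondeg b}.

(** The converse of taking a sum of grafts apart: the top layer [u] and the lower part [v] can be
    prescribed freely and are recovered by [prune] and [unpruned]. *)
Lemma grafts_addP l m (u : l.+1.-tuple X -> series) v :
  (forall b : l.+1.-tuple X, nondeg b -> shifted l.+2 m (u b)) -> grafts op l m v ->
  let w := \sum_(b : l.+1.-tuple X | nondeg b) graft op l b (u b) + v in
  [/\ grafts op l.+1 m w, forall b : l.+1.-tuple X, nondeg b -> prune b w = u b &
      unpruned op l w = v].
Proof.
move=> um [f [fm vE]] w.
(* [insub] tests whether [b] has [l.+1] letters; if so the coefficient comes from [u], otherwise
   from the lower part. *)
pose g (b : seq X) := if insub b is Some t then if nondeg b then u t else 0 else f b.
have gE (b : l.+1.-tuple X) : nondeg b -> g b = u b.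
  by move=> bn; rewrite /g valK bn.
have wE : w = \sum_(i < l.+1) \sum_(b : i.+1.-tuple X | nondeg b) graft op i b (g b).
  rewrite /w vE big_ord_recr /= addrC; congr (_ + _).
    by apply: eq_bigr => b bn; rewrite gE.
  apply: eq_bigr => i _; apply: eq_bigr => b _; rewrite /g insubF // size_tuple.
  by apply/eqP => -[E]; have := ltn_ord i; rewrite E ltnn.
have gw (b : l.+1.-tuple X) : nondeg b -> prune b w = u b.
  by move=> bn; rewrite wE prune_grafts // gE.
split=> //.
  exists g; split=> // b; rewrite /g; case: insubP => [t _ tb|_]; last exact: fm.
  by case: ifP => [bn|_]; [rewrite -tb size_tuple; apply: um; rewrite tb | apply: shifted0].
rewrite /unpruned; under [X in _ - X]eq_bigr => b bn do rewrite gw //.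
by rewrite /w addrC addKr.
Qed.

Lemma prune_shifted l m c (b : l.+1.-tuple X) :
  grafts op l.+1 m c -> shifted l.+2 m (prune b c).
Proof.
move=> /grafts_degenerates[cm _].
have := shifted_prune (b := b) _ cm; rewrite size_tuple add0n; exact.
Qed.

(** On sums of grafts [del] acts coefficientwise, and [prune b] reads off the coefficient at [b]. *)
Lemma prune_del l m c (b : l.+1.-tuple X) : nondeg b -> grafts op l.+1 m c ->
  prune b (del c) = del (prune b c).
Proof.
move=> bn [f [_ ->]]; rewrite prune_grafts //.
rewrite -[RHS](prune_grafts op (fun b : seq X => del (f b)) bn).
congr prune; rewrite linear_sum; apply: eq_bigr => i _.
rewrite linear_sum; apply: eq_bigr => t _.
by rewrite /= del_graft ?size_tuple.
Qed.

(** The top layer splits off as complexes: [prune] and [unpruned] commute with [del], and each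
    nondegenerate word of [l.+1] letters carries a copy of all chains, shifted by the [l.+2] letters
    of T(b). *)
Lemma H_graftS l m :
  lmod_isomorphic (H (G l.+1) m)
    ({ffun nondeg_word l -> H (C l.+2) m} * H (G l) m)%type.
Proof.
have ZP (b : nondeg_word l) z : cycle (G l.+1) m z -> cycle (C l.+2) m (prune (val b) z).
  case=> zm dz; split; first exact: prune_shifted.
  by rewrite -(prune_del (valP b) zm) /= dz linear0.
have delU k z : grafts op l.+1 k z -> del (unpruned op l z) = unpruned op l (del z).
  move=> zm; rewrite /unpruned linearB linear_sum; congr (_ - _).
  by apply: eq_bigr => b bn; rewrite /= del_graft ?size_tuple // -(prune_del bn zm).
have U0 : unpruned op l (0 : series) = 0.
  by rewrite /unpruned big1 ?subrr // => b _; rewrite !linear0.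
have ZU z : cycle (G l.+1) m z -> cycle (G l) m (unpruned op l z).
  case=> zm dz; split; first exact: unpruned_grafts.
  by rewrite (delU m) // /= dz U0.
apply: (H_iso (F := fun z =>
  ([ffun b : nondeg_word l => hclass (C l.+2) m (prune (val b) z)],
   hclass (G l) m (unpruned op l z)))).
- move=> a u v Zu Zv; congr pair.
    apply/ffunP => b; rewrite !ffunE linearP /= hclassP //; exact: ZP.
  rewrite -hclassP; [|exact: ZU|exact: ZU]; congr hclass.
  rewrite /unpruned scalerBr addrACA -opprD; congr (_ - _).
  rewrite scaler_sumr -big_split; apply: eq_bigr => b _.
  by rewrite /= !linearP.
- move=> z Zz; have [zm dz] := Zz; split=> [[/ffunP BP /hclass_eq0 BU]|[w wm wz]].
    (* Chains bounding each component are chosen separately, then reassembled with [grafts_addP]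
       into one chain bounding [z]. *)
    have /choice[u uP] (b : l.+1.-tuple X) : exists u, nondeg b ->
        shifted l.+2 m.+1 u /\ del u = prune b z.
      have [bn|bn] := boolP (nondeg b); last by exists 0.
      have := BP (exist _ b bn); rewrite !ffunE => /hclass_eq0[|u um uz].
        exact: (ZP (exist _ b bn)).
      by exists u.
    have [|v vm vz] := BU; first exact: ZU.
    have [//|wm _ _] := @grafts_addP l m.+1 u v _ vm; first by move=> b /uP[].
    exists (\sum_(b : l.+1.-tuple X | nondeg b) graft op l b (u b) + v) => //.
    rewrite linearD linear_sum /= vz addrC.
    rewrite -[RHS](subrK (\sum_(b : l.+1.-tuple X | nondeg b) graft op l b (prune b z))).
    congr (_ + _); apply: eq_bigr => b bn.
    by rewrite del_graft ?size_tuple //; case: (uP b bn) => _ <-.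
  congr pair.
    apply/ffunP => b; rewrite !ffunE; apply/hclass_eq0; first exact: ZP.
    exists (prune (val b) w); first exact: prune_shifted.
    by rewrite -(prune_del (valP b) wm) /= wz.
  apply/hclass_eq0; first exact: ZU.
  exists (unpruned op l w); first exact: unpruned_grafts.
  by rewrite (delU m.+1) //= wz.
- move=> [h1 h2].
  have /choice[u uP] (b : l.+1.-tuple X) : exists u, forall bn : nondeg b,
      cycle (C l.+2) m u /\ hclass (C l.+2) m u = h1 (exist _ b bn).
    have [bn|/negP bn] := pselect (nondeg b); last by exists 0 => bn'; rewrite bn' in bn.
    have [u Zu uE] := hclass_surj (h1 (exist _ b bn)).
    by exists u => bn'; rewrite (bool_irrelevance bn' bn).
  have [v [vm dv] <-] := hclass_surj h2.
  have [|wm wu wv] := @grafts_addP l m u v _ vm.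
    by move=> b bn; have [[]] := uP b bn.
  exists (\sum_(b : l.+1.-tuple X | nondeg b) graft op l b (u b) + v).
    split=> //; rewrite linearD linear_sum /= dv addr0 big1 // => b bn.
    by rewrite del_graft ?size_tuple //; have [[_ /= ->] _] := uP b bn; rewrite linear0.
  congr pair; last by rewrite wv.
  apply/ffunP => -[b bn]; rewrite ffunE /= wu //.
  by have [_ ->] := uP b bn.
Qed.

End WordHomology.

(** * Calculus of isomorphisms between products, powers and direct sums *)

Notation "U ~= V" := (lmod_isomorphic U V) (at level 70, no associativity).

Section Isomorphisms.
Variable R : pzRingType.
Implicit Types (U V W : lmodType R) (k l : nat).

Lemma iso_can U V (f : U -> V) (g : V -> U) :
  linear f -> cancel f g -> cancel g f -> U ~= V.
Proof.
move=> flin fK gK; pose fL := GRing.isLinear.Build R U V *:%R f flin.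
pose f' : {linear U -> V} := HB.pack f fL.
by exists f', g.
Qed.

Lemma iso_refl U : U ~= U.
Proof. exact: (iso_can (f := id) (g := id)). Qed.

Lemma iso_sym U V : U ~= V -> V ~= U.
Proof.
move=> [f [g fK gK]]; apply: (iso_can (f := g) (g := f)) => // a u v.
by apply: (can_inj fK); rewrite linearP !gK.
Qed.

Lemma iso_trans V U W : U ~= V -> V ~= W -> U ~= W.
Proof.
move=> [f [f' fK f'K]] [g [g' gK g'K]].
apply: (iso_can (f := g \o f) (g := f' \o g')); [|exact: can_comp|exact: can_comp].
by move=> a u v; rewrite /= !linearP.
Qed.

Lemma iso_prod U U' V V' : U ~= U' -> V ~= V' -> (U * V)%type ~= (U' * V')%type.
Proof.
move=> [f [f' fK f'K]] [g [g' gK g'K]].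
apply: (iso_can (f := fun u => (f u.1, g u.2)) (g := fun u => (f' u.1, g' u.2))).
- by move=> a u v; rewrite /= !linearP.
- by case=> u v /=; rewrite fK gK.
- by case=> u v /=; rewrite f'K g'K.
Qed.

Lemma iso_prodC U V : (U * V)%type ~= (V * U)%type.
Proof. by apply: (iso_can (f := fun u => (u.2, u.1)) (g := fun u => (u.2, u.1))) => // -[]. Qed.

Lemma iso_prodA U V W : (U * (V * W))%type ~= (U * V * W)%type.
Proof.
by apply: (iso_can (f := fun u : U * (V * W) => ((u.1, u.2.1), u.2.2))
  (g := fun u : U * V * W => (u.1.1, (u.1.2, u.2)))) => [a u v|[? []]|[[]]].
Qed.

Lemma iso_prodCA U V W : (U * (V * W))%type ~= (V * (U * W))%type.
Proof.
apply: iso_trans (iso_prodA _ _ _) _; apply: iso_trans (iso_sym (iso_prodA _ _ _)).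
by apply: iso_prod (iso_refl _); apply: iso_prodC.
Qed.

Lemma iso_prodACA U V U' V' :
  ((U * V) * (U' * V'))%type ~= ((U * U') * (V * V'))%type.
Proof.
apply: iso_trans (iso_sym (iso_prodA _ _ _)) _; apply: iso_trans (iso_prodA _ _ _).
by apply: iso_prod (iso_refl _) _; apply: iso_prodCA.
Qed.

Lemma iso_prod0 U : ('rV[R]_0 * U)%type ~= U.
Proof.
apply: (iso_can (f := snd) (g := fun u => (0, u))) => // -[z u] /=.
by congr pair; apply/rowP; case.
Qed.

Lemma iso_ffun (I : finType) k U : #|I| = k -> ({ffun I -> U} : lmodType R) ~= direct_power U k.
Proof.
move=> <-; apply: (iso_can (f := fun u : {ffun I -> U} => [ffun i => u (enum_val i)])
    (g := fun u : {ffun 'I_#|I| -> U} => [ffun i => u (enum_rank i)])).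
- by move=> a u v; apply/ffunP => i; rewrite !ffunE.
- by move=> u; apply/ffunP => i; rewrite !ffunE enum_rankK.
- by move=> u; apply/ffunP => i; rewrite !ffunE enum_valK.
Qed.

Lemma iso_power U V k : U ~= V -> direct_power U k ~= direct_power V k.
Proof.
move=> [f [g fK gK]]; apply: (iso_can (f := fun u : {ffun 'I_k -> U} => [ffun i => f (u i)])
    (g := fun u : {ffun 'I_k -> V} => [ffun i => g (u i)])).
- by move=> a u v; apply/ffunP => i; rewrite !ffunE linearP.
- by move=> u; apply/ffunP => i; rewrite !ffunE fK.
- by move=> u; apply/ffunP => i; rewrite !ffunE gK.
Qed.

Lemma iso_power0 U : direct_power U 0 ~= 'rV[R]_0.
Proof.
apply: (iso_can (f := fun=> 0) (g := fun=> [ffun=> 0])).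
- by move=> a u v; rewrite scaler0 addr0.
- by move=> u; apply/ffunP; case.
- by move=> u; apply/rowP; case.
Qed.

Lemma iso_power_zero k : direct_power 'rV[R]_0 k ~= 'rV[R]_0.
Proof.
apply: (iso_can (f := fun=> 0) (g := fun=> [ffun=> 0])).
- by move=> a u v; rewrite scaler0 addr0.
- by move=> u; apply/ffunP => i; apply/rowP; case.
- by move=> u; apply/rowP; case.
Qed.

Lemma iso_power_prod U V k :
  direct_power (U * V)%type k ~= (direct_power U k * direct_power V k)%type.
Proof.
apply: (iso_can
    (f := fun u : {ffun 'I_k -> U * V} => ([ffun i => (u i).1], [ffun i => (u i).2]))
    (g := fun u : {ffun 'I_k -> U} * {ffun 'I_k -> V} => [ffun i => (u.1 i, u.2 i)])).
- by move=> a u v; congr pair; apply/ffunP => i; rewrite !ffunE.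
- by move=> u; apply/ffunP => i; rewrite !ffunE /=; case: (u i).
- by case=> u v; congr pair; apply/ffunP => i; rewrite !ffunE.
Qed.

Lemma iso_power_add U k l :
  direct_power U (k + l)%N ~= (direct_power U k * direct_power U l)%type.
Proof.
refine (@iso_can (direct_power U (k + l)%N) (direct_power U k * direct_power U l)%type
    (fun u : {ffun 'I_(k + l)%N -> U} =>
       ([ffun i => u (lshift l i)], [ffun i => u (rshift k i)]))
    (fun u : {ffun 'I_k -> U} * {ffun 'I_l -> U} =>
       [ffun i => match fintype.split i with inl j => u.1 j | inr j => u.2 j end]) _ _ _).
- by move=> a u v; congr pair; apply/ffunP => i; rewrite !ffunE.
- move=> u; apply/ffunP => i; rewrite ffunE; rewrite -[in RHS](fintype.splitK i).
  by case: (fintype.split i) => j; rewrite ffunE.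
- case=> u v; congr pair; apply/ffunP => i; rewrite !ffunE.
    by rewrite -[lshift l i]/(unsplit (inl i)) fintype.unsplitK.
  by rewrite -[rshift k i]/(unsplit (inr i)) fintype.unsplitK.
Qed.

Lemma iso_power_mul U k l : direct_power U (k * l)%N ~= direct_power (direct_power U k) l.
Proof.
apply: iso_sym; pose T := ('I_l * 'I_k)%type.
apply: (@iso_trans ({ffun T -> U} : lmodType R)); last first.
  by apply: iso_ffun; rewrite card_prod !card_ord mulnC.
apply: (iso_can
    (f := fun u : {ffun 'I_l -> {ffun 'I_k -> U}} => [ffun p : T => u p.1 p.2])
    (g := fun u : {ffun T -> U} => [ffun i => [ffun j => u (i, j)]])).
- by move=> a u v; apply/ffunP => i; rewrite !ffunE.
- by move=> u; apply/ffunP => i; apply/ffunP => j; rewrite !ffunE.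
- by move=> u; apply/ffunP => -[i j]; rewrite !ffunE.
Qed.

Implicit Types M : nat -> lmodType R.

Lemma direct_sum_iso M M' n : (forall p, (0 < p <= n)%N -> M p ~= M' p) ->
  direct_sum M n ~= direct_sum M' n.
Proof.
elim: n => [|n IHn] MM'; first exact: iso_refl.
apply: iso_prod; last by apply: MM'; rewrite leqnn.
by apply: IHn => p /andP[p0 pn]; apply: MM'; rewrite p0 leqW.
Qed.

Lemma direct_sum_prod M M' n :
  direct_sum (fun p => M p * M' p)%type n ~= (direct_sum M n * direct_sum M' n)%type.
Proof.
elim: n => [|n IHn]; first exact: iso_sym (iso_prod0 _).
apply: iso_trans (iso_prodACA _ _ _ _).
by apply: iso_prod (iso_refl _).
Qed.

Lemma direct_sum_power M k n :
  direct_sum (fun p => direct_power (M p) k) n ~= direct_power (direct_sum M n) k.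
Proof.
elim: n => [|n IHn]; first exact: iso_sym (iso_power_zero k).
apply: iso_trans (iso_sym (iso_power_prod _ _ _)).
by apply: iso_prod (iso_refl _).
Qed.

Lemma direct_sum_recl M n :
  direct_sum M n.+1 ~= (M 1%N * direct_sum (fun p => M p.+1) n)%type.
Proof.
elim: n => [|n IHn] /=; first exact: iso_prodC.
by apply: iso_trans (iso_sym (iso_prodA _ _ _)); apply: iso_prod (iso_refl _).
Qed.

End Isomorphisms.

(** * Counting words and solving the recursion *)

Section WordHomologyRecursion.
Variables (R : comPzRingType) (X : finType) (op : X -> X -> X).
Hypothesis spX : spindle op.
Let q := #|X|.

Local Notation H := subhomology.
Local Notation C := (shifted_complex R op).
Local Notation D := (degenerate_subcomplex R spX).
Local Notation N := (norm_subcomplex R spX).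
Local Notation G := (graft_subcomplex R spX).

Lemma card_nondeg_word0 : #|{: nondeg_word X 0}| = q.
Proof.
rewrite card_sig; transitivity #|{: 1.-tuple X}|; last by rewrite card_tuple expn1.
by apply: eq_card => b; rewrite !inE; case/tupleP: b => x b; rewrite tuple0.
Qed.

(** A nondegenerate word is extended on the right by any letter other than its head. *)
Lemma card_nondeg_wordS l :
  #|{: nondeg_word X l.+1}| = (#|{: nondeg_word X l}| * q.-1)%N.
Proof.
rewrite !card_sig -!sum1_card.
rewrite (reindex (fun p : l.+1.-tuple X * X => cons_tuple p.2 p.1)) /=; last first.
  exists (fun t : l.+2.-tuple X => (behead_tuple t, thead t)) => t _.
    by case: t => t x; congr pair; apply: val_inj.
  by apply: val_inj; rewrite /= [in RHS](tuple_eta t).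
rewrite (eq_bigl (fun p : l.+1.-tuple X * X => nondeg p.1 && (p.2 != thead p.1))).
  rewrite -(pair_big_dep (fun t : l.+1.-tuple X => nondeg t)
    (fun (t : l.+1.-tuple X) x => x != thead t) (fun _ _ => 1%N)) /= big_distrl /=.
  by apply: eq_bigr => t _; rewrite mul1n sum1_card cardC1.
by case=> t x; case/tupleP: t => y t; rewrite /= theadE andbC.
Qed.

(** The first layer gives [q] copies of [H (C 2) m.+1]. Each later layer in length [m.+1] is [q.-1]
    copies of the preceding layer in length [m], as one more letter of [b] shifts the coefficients
    by one; together they form [q.-1] copies of [H D m]. *)
Lemma H_degenerate_rec m :
  H D m.+1 ~= (direct_power (H (C 2) m.+1) q * direct_power (H D m) q.-1)%type.
Proof.
suff GS l : H (G l.+1) m.+1 ~=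
    (direct_power (H (C 2) m.+1) q * direct_power (H (G l) m) q.-1)%type.
  apply: iso_trans (H_graft_degenerate R spX _) _; apply: iso_trans (GS m) _.
  by apply: iso_prod (iso_refl _) _; apply/iso_power/iso_sym/H_graft_degenerate.
elim: l => [|l IHl]; apply: iso_trans (H_graftS R spX _ _) _.
  apply: iso_prod; first exact/iso_ffun/card_nondeg_word0.
  apply: iso_trans (H_graft0 R spX _) _; apply: iso_sym.
  by apply: iso_trans (iso_power _ (H_graft0 R spX _)) (iso_power_zero _ _).
apply: (iso_trans (iso_prod _ IHl)).
  apply: iso_trans (iso_ffun _ (card_nondeg_wordS l)) _.
  apply: iso_trans (iso_power _ (H_shifted R op _ _)) _; exact: iso_power_mul.
apply: iso_trans (iso_prodCA _ _ _) _; apply: iso_prod (iso_refl _) _.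
apply: iso_trans (iso_sym (iso_power_prod _ _ _)) _; apply/iso_power/iso_sym.
apply: iso_trans (H_graftS R spX _ _) _; apply: iso_prod (iso_refl _).
exact: iso_ffun.
Qed.

Lemma H_degenerate_small m : (m <= 1)%N -> H D m ~= 'rV[R]_0.
Proof.
move=> m1; apply: H_trivial => v [vm vn]; apply/funext => s.
have [sm|sm] := eqVneq (size s + 0)%N m; last by rewrite vm.
rewrite vn //; move: m1; rewrite -sm addn0; by case: s {sm} => [|x []].
Qed.

Lemma H_degenerate_rec2 m : H D m.+2 ~=
  (direct_power (H N m) q *
    (direct_power (H D m) q * direct_power (H D m.+1) q.-1))%type.
Proof.
apply: iso_trans (H_degenerate_rec _) _; apply: iso_trans (iso_sym (iso_prodA _ _ _)).
apply: iso_prod (iso_refl _); apply: iso_trans (iso_power_prod _ _ _); apply: iso_power.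
apply: iso_trans (H_shifted R op _ _) _; apply: iso_trans (H_shifted R op _ _) _.
exact: H_split.
Qed.

Lemma multiplicity_nat p :
  (multiplicity q p)%:R * (1 + q%:R) = q%:R * (q%:R ^+ p - (-1) ^+ p) :> rat.
Proof.
by rewrite multiplicityE mulrAC divfK // nat1r Num.Theory.pnatr_eq0.
Qed.

Lemma multiplicity0 : multiplicity q 0 = 0%N.
Proof. by rewrite /multiplicity !expr0 subrr mulr0 div0z. Qed.

Lemma multiplicity_eq p k :
  k%:R * (1 + q%:R) = q%:R * (q%:R ^+ p - (-1) ^+ p) :> rat -> multiplicity q p = k.
Proof.
rewrite -multiplicity_nat => /mulIf E; apply/eqP.
rewrite -(Num.Theory.eqr_nat rat); apply/eqP/esym/E.
by rewrite nat1r Num.Theory.pnatr_eq0.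
Qed.

Lemma multiplicity1 : multiplicity q 1 = q.
Proof. by apply: multiplicity_eq; rewrite !expr1 opprK [1 + _]addrC. Qed.

(** [q] and -1 are the roots of t^2 - (q - 1) t - q. *)
Lemma multiplicity_rec p :
  multiplicity q p.+2 = (multiplicity q p * q + multiplicity q p.+1 * q.-1)%N.
Proof.
(* The case of empty [X] is separate because [q.-1] truncates at 0. *)
apply: multiplicity_eq; case: q (multiplicity_nat p) (multiplicity_nat p.+1) => [|r].
  by rewrite !muln0 !mul0r.
move: (multiplicity _ _) (multiplicity _ _) => b a ea eb; rewrite succnK natrD !natrM.
transitivity (r.+1%:R * (a%:R * (1 + r.+1%:R)) + r%:R * (b%:R * (1 + r.+1%:R)) : rat).
  by rewrite mulrDl; congr (_ + _); rewrite mulrAC mulrC.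
by rewrite ea eb !exprS -natr1; ring.
Qed.

(** Here [m] counts letters, so the degree is [m.-1]. In the strong induction, the [H N] term of the
    recursion is the summand p = 1, and the two [H D] terms combine into the other summands by
    [multiplicity_rec]. *)
Lemma H_degenerate_sum m : H D m ~= direct_sum
  (fun p => direct_power (H N (m.-1 - p)%N) (multiplicity q p)) m.-1.
Proof.
elim/ltn_ind: m => -[|[|m]] IHm; try exact: H_degenerate_small.
apply: iso_trans (H_degenerate_rec2 _) _; apply: iso_sym.
apply: iso_trans (direct_sum_recl _ _) _.
rewrite multiplicity1 subSS subn0; apply: iso_prod (iso_refl _) _.
(* [A] collects the contribution of [H D m], and [B] that of [H D m.+1]. *)
pose A p := direct_power (H N (m - p)) (multiplicity q p.-1 * q).
pose B p := direct_power (H N (m - p)) (multiplicity q p * q.-1).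
apply: (@iso_trans _ (direct_sum A m * direct_sum B m)%type).
  apply: iso_trans (direct_sum_prod _ _ _); apply: direct_sum_iso => -[|p] // _.
  by rewrite multiplicity_rec subSS; apply: iso_power_add.
apply: iso_prod; last first.
  apply: iso_trans (iso_power _ (iso_sym (IHm m.+1 _))) => //.
  apply: iso_trans (direct_sum_power _ _ _); apply: direct_sum_iso => p _.
  exact: iso_power_mul.
apply: iso_trans (iso_power _ (iso_sym (IHm m _))) => //.
apply: iso_trans (direct_sum_power _ _ _).
case: m @A @B {IHm} => [|m] A B; first exact: iso_refl.
apply: iso_trans (direct_sum_recl _ _) _.
(* [A 1] vanishes since [multiplicity q 0] is 0; dropping it aligns the indices with the sum for
   [H D m]. *)
apply: (@iso_trans _ ('rV[R]_0 * direct_sum (fun p => A p.+1) m)%type).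
  apply: iso_prod (iso_refl _); rewrite /A /= multiplicity0 mul0n; exact: iso_power0.
apply: iso_trans (iso_prod0 _) _; apply: direct_sum_iso => p _.
rewrite /A subSS; exact: iso_power_mul.
Qed.

End WordHomologyRecursion.

(** * Comparison with the complexes of the statement *)

Section WordChains.
Variables (R : comPzRingType) (X : finType) (op : X -> X -> X).
Hypothesis spX : spindle op.

Notation series := (series R X).
Notation act := (act op).
Notation del := (del op : {linear series -> series}).
Implicit Types (c : series) (s : seq X) (x : X) (m n : nat).

Definition letters m (w : word X m) : seq X := [seq w i | i <- enum 'I_m].

Lemma size_letters m (w : word X m) : size (letters w) = m.
Proof. by rewrite size_map size_enum_ord. Qed.

Lemma letters_inj m : injective (@letters m).
Proof.
by move=> w w' /eq_in_map ww'; apply/ffunP => i; apply: ww'; rewrite mem_enum.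
Qed.

Lemma letters_onto m s : size s = m -> exists w : word X m, letters w = s.
Proof.
move=> /eqP sm; exists [ffun i => tnth (Tuple sm) i].
rewrite -[RHS](map_tnth_enum (Tuple sm)).
by apply: eq_map => i; rewrite ffunE.
Qed.

Definition tail m (w : word X m.+1) : word X m := [ffun i => w (lift ord0 i)].

Lemma letters_cons m (w : word X m.+1) : letters w = w ord0 :: letters (tail w).
Proof.
rewrite /letters enum_ordSl /= -map_comp; congr cons.
by apply: eq_map => i; rewrite ffunE.
Qed.

Lemma letters_face0 m (w : word X m.+1) :
  letters (face op ord0 w) = map (op^~ (w ord0)) (letters (tail w)).
Proof. by rewrite -map_comp; apply: eq_map => i; rewrite /= !ffunE ltn0. Qed.

Lemma letters_faceS m (w : word X m.+2) (i : 'I_m.+1) :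
  letters (face op (lift ord0 i) w) = w ord0 :: letters (face op i (tail w)).
Proof.
suff E : tail (face op (lift ord0 i) w) = face op i (tail w).
  by rewrite letters_cons E ffunE /=; congr (w _ :: _); apply: val_inj.
apply/ffunP => j; rewrite !ffunE /= /bump !add1n ltnS /=.
by case: ifP => _; [|congr op]; congr (w _); apply: val_inj; rewrite /= /bump; lia.
Qed.

Definition dirac s : series := fun t => (t == s)%:R.

Lemma dirac_cons x s : dirac (x :: s) = push x (dirac s).
Proof. by apply/funext => -[|y t] //; rewrite /dirac eqseq_cons /=; case: eqP. Qed.

Lemma act_dirac x s : act x (dirac s) = dirac (map (op^~ x) s).
Proof.
elim: s => [|y s IHs]; last by rewrite !dirac_cons act_push IHs.
apply: series_eq => // z; rewrite pop_act big1 // => y _; exact: linear0.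
Qed.

Lemma sgn_dirac s : sgn (dirac s) = (-1) ^+ size s *: dirac s.
Proof.
apply/funext => t; rewrite /sgn /dirac seriesZ.
by case: eqP => [->|] //; rewrite !mulr0.
Qed.

Lemma del_dirac_nil : del (dirac [::]) = 0.
Proof.
have EA : erase_act op (dirac [::]) = 0.
  by rewrite /erase_act big1 // => x _; exact: linear0.
apply: series_eq => [|x]; first by rewrite /= EA linear0 addr0.
have E : sgn (pop x (0 : series)) = 0 by rewrite !linear0.
by rewrite pop_del EA E subr0; exact: linear0.
Qed.

(** Face 0 is the term where x_0 acts; the other faces keep x_0 and come from the tail, with the
    same sign since m and i both drop by one. *)
Lemma del_dirac m (w : word X m.+1) : del (dirac (letters w)) =
  \sum_(i < m.+1) (-1) ^+ (m - i) *: dirac (letters (face op i w)).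
Proof.
elim: m w => [|m IHm] w; rewrite letters_cons dirac_cons /= del_push act_dirac.
  rewrite big_ord_recl big_ord0 addr0 letters_face0 subn0 expr0 scale1r.
  rewrite (size0nil (size_letters (tail w))) del_dirac_nil linear0 add0r.
  by rewrite sgn_dirac /= expr0 scale1r.
rewrite IHm linear_sum [RHS]big_ord_recl addrC subn0 sgn_dirac size_map size_letters.
rewrite letters_face0; congr (_ + _); apply: eq_bigr => i _.
by rewrite linearZ /= letters_faceS dirac_cons.
Qed.

(** The sum has at most one term because [letters] is injective; this form gives linearity
    directly. *)
Definition embed m (c : freemod R (word X m)) : series :=
  fun s => \sum_(w | letters w == s) c w.

Lemma embed_is_linear m : linear (@embed m).
Proof.
move=> a c1 c2; apply/funext => s; rewrite !seriesE /embed mulr_sumr -big_split.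
by apply: eq_bigr => w _; rewrite !ffunE.
Qed.
HB.instance Definition _ m :=
  GRing.isLinear.Build R (freemod R (word X m)) series *:%R (@embed m)
    (@embed_is_linear m).

Lemma embed_letters m (c : freemod R (word X m)) w : embed c (letters w) = c w.
Proof.
rewrite /embed (bigD1 w) //= big1 ?addr0 // => w' /andP[/eqP/letters_inj-> ].
by rewrite eqxx.
Qed.

Lemma embed_inj m : injective (@embed m).
Proof. by move=> c1 c2 cc; apply/ffunP => w; rewrite -!embed_letters cc. Qed.

Lemma embed_shifted m (c : freemod R (word X m)) : shifted 0 m (embed c).
Proof.
move=> s; rewrite addn0 => sm; rewrite /embed big1 // => w /eqP ws.
by rewrite -ws size_letters eqxx in sm.
Qed.

Lemma embed_onto m c : shifted 0 m c ->
  embed ([ffun w => c (letters w)] : freemod R (word X m)) = c.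
Proof.
move=> cm; apply/funext => s; have [sm|sm] := eqVneq (size s) m.
  by have [w <-] := letters_onto sm; rewrite embed_letters ffunE.
by rewrite cm ?embed_shifted ?addn0.
Qed.

Lemma embed_gen m (w : word X m) : embed (gen R w) = dirac (letters w).
Proof.
apply/funext => s; rewrite /dirac; have [->|sw] := eqVneq s (letters w).
  by rewrite embed_letters ffunE !eqxx.
rewrite /embed big1 ?(negPf sw) // => w' /eqP ws; rewrite ffunE.
by case: eqP => // ww; rewrite -ws ww eqxx in sw.
Qed.

Lemma embed_diff n (c : spindle_chains R X n.+1) :
  embed (spindle_diff R op n c) = del (embed c).
Proof.
pose f : {linear spindle_chains R X n.+1 -> series} := @embed _ \o spindle_diff R op n.
pose g : {linear spindle_chains R X n.+1 -> series} := del \o @embed _.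
apply: (free_linear_eq (f := f) (g := g)) => w.
rewrite /f /g /= spindle_diff_gen embed_gen del_dirac linear_sum.
by apply: eq_bigr => i _; rewrite linearZ /= embed_gen.
Qed.

Lemma degenerate_nondeg m (w : word X m.+1) : degenerate w = ~~ nondeg (letters w).
Proof.
have E (i : 'I_m.+1) : nth (w ord0) (letters w) i = w i.
  by rewrite (nth_map ord0) ?size_enum_ord // nth_ord_enum.
apply/existsP/idP => [[i /existsP[j /andP[/eqP ji /eqP wij]]]|].
  apply/(sortedP (w ord0)) => /(_ i); rewrite size_letters -ji ltn_ord => /(_ isT).
  by rewrite !E wij eqxx.
apply: contraNP => wn; apply/(sortedP (w ord0)) => i; rewrite size_letters => im.
apply/negP => wi; case: wn; exists (Ordinal (ltnW im)); apply/existsP.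
by exists (Ordinal im); rewrite /= eqxx -(E (Ordinal (ltnW im))) -(E (Ordinal im)).
Qed.

Lemma spannedP (B : finType) (P : pred B) (c : freemod R B) :
  c \in spanned R P <-> forall b, ~~ P b -> c b = 0.
Proof.
split=> [/asboolP[a ->] b Pb|c0].
  rewrite sum_ffunE big1 // => b' Pb'; rewrite !ffunE.
  by case: eqP => [bb'|_]; [rewrite bb' Pb' in Pb | rewrite scaler0].
apply/asboolP; exists c; rewrite [LHS]freemod_sum [RHS]big_mkcond.
by apply: eq_bigr => b _; case: ifPn => // /c0->; rewrite scale0r.
Qed.

Lemma embed_degenerates n (c : spindle_chains R X n) :
  c \in degenerate_chains R X n <-> degenerates n.+1 (embed c).
Proof.
rewrite spannedP; split=> [c0|[_ c0] w].
  split=> [|s sn]; first exact: embed_shifted.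
  rewrite /embed big1 // => w /eqP ws; apply: c0.
  by rewrite degenerate_nondeg ws sn.
by rewrite degenerate_nondeg negbK -embed_letters => /c0.
Qed.

Lemma HD_iso n : HD R spX n ~= subhomology (degenerate_subcomplex R spX) n.+1.
Proof.
pose phi k (z : degenerate_complex R spX k) : series := embed (submod_val z).
have phi_lin k : linear (phi k) by move=> a u v; rewrite /phi /= linearP.
pose phiL k := GRing.isLinear.Build R (degenerate_complex R spX k) series *:%R _ (phi_lin k).
pose phi' k : {linear degenerate_complex R spX k -> series} := HB.pack (phi k) (phiL k).
apply: (@homology_H R series del (degenerate_complex R spX) _ 1%N phi').
- by move=> k u v /embed_inj; apply: val_inj.
- move=> k v; split=> [vD|[u <-]]; last exact/embed_degenerates/valP.
  have [vm _] := vD; have vE := embed_onto vm.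
  have uD : [ffun w => v (letters w)] \in degenerate_chains R X k.
    by apply/embed_degenerates; rewrite vE.
  by exists (Submodule uD).
- by move=> k c; rewrite /= /phi /= embed_diff.
(* This boundary is a degenerate chain of length 0, hence zero: the empty word is nondegenerate. *)
- move=> c; have /embed_degenerates cD := valP c.
  apply/funext => s; have [dm dn] := part_d (s := degenerate_subcomplex R spX) cD.
  by have [s0|] := boolP (nondeg s); [apply: dn | case: s => [|x s] // _; apply: dm].
Qed.

Definition norm_embed n : {linear spindle_chains R X n -> series} :=
  (@norm R X : {linear series -> series}) \o @embed n.+1.

Lemma norm_embed_degenerate n (u : spindle_chains R X n) :
  u \in degenerate_chains R X n -> norm_embed n u = 0.
Proof. by move/embed_degenerates/norm_degenerates. Qed.

Definition embed_empty (r : R^o) : series := r *: dirac [::].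

Lemma embed_empty_is_linear : linear embed_empty.
Proof. by move=> a r t; rewrite /embed_empty scalerDl scalerA. Qed.
HB.instance Definition _ :=
  GRing.isLinear.Build R R^o series *:%R embed_empty embed_empty_is_linear.

Lemma embed_empty_nil r : embed_empty r [::] = r.
Proof. by rewrite /embed_empty seriesZ /dirac eqxx mulr1. Qed.

Lemma embed_empty_cons r x s : embed_empty r (x :: s) = 0.
Proof. by rewrite /embed_empty seriesZ mulr0. Qed.

Lemma embed_empty_shifted r : shifted 0 0 (embed_empty r).
Proof. by case=> // x s _; apply: embed_empty_cons. Qed.

Lemma norm_embed_empty r : norm (embed_empty r) = embed_empty r.
Proof.
apply/funext => -[|x s] //; rewrite [RHS]embed_empty_cons.
exact: (shifted_norm (@embed_empty_shifted r)).
Qed.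

Lemma embed_augmentation (u : spindle_chains R X 0) :
  embed_empty (free_ext (fun=> 1 : R^o) u) = del (embed u).
Proof.
pose f : {linear spindle_chains R X 0 -> series} :=
  embed_empty \o free_ext (fun=> 1 : R^o).
pose g : {linear spindle_chains R X 0 -> series} := del \o @embed _.
apply: (free_linear_eq (f := f) (g := g)) => w.
rewrite /f /g /= free_ext_gen embed_gen del_dirac big_ord1 subnn expr0.
by rewrite (size0nil (size_letters _)).
Qed.

(** Degree -1 goes to the multiples of the empty word. Normalized chains go through [norm], which is
    well defined on the quotient because [norm] kills degenerate chains. *)
Definition aug_embed j : {linear aug_complex (@eps_diff R X op spX) j -> series} :=
  match j with
  | 0 => embed_empty
  | n.+1 => quotmod_lift (@norm_embed_degenerate n)
  end.

(** The position in [aug_complex] is the number of letters, so degree n - 1 - p sits at position n -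
    p. *)
Lemma HNred_iso n p : (p <= n)%N ->
  HNred R spX (n%:Z - 1 - p%:Z) ~= subhomology (norm_subcomplex R spX) (n - p)%N.
Proof.
move=> pn.
have -> : HNred R spX (n%:Z - 1 - p%:Z) =
    homology (aug_complex (@eps_diff R X op spX)) (n - p).
  have [->|np] := eqVneq p n.
    by rewrite subnn; have -> : n%:Z - 1 - n%:Z = Negz 0 by lia.
  have -> : n%:Z - 1 - p%:Z = Posz (n - p).-1 by lia.
  by have -> : (n - p)%N = (n - p).-1.+1 by lia.
apply: (@homology_H R series del (aug_complex (@eps_diff R X op spX)) _ 0%N aug_embed).
- case=> [|k] u v.
    by move/(congr1 (fun f => f [::])); rewrite /= !embed_empty_nil.
  rewrite -[u]quotmod_reprK -[v]quotmod_reprK /= !quotmod_lift_pi => E.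
  apply/quotmod_eqP/embed_degenerates; set w := quotmod_repr u - _.
  (* [norm] kills [embed w], which therefore equals its own degenerate component. *)
  have <- : embed w - norm (embed w) = embed w.
    rewrite -[norm (embed w)]/(norm_embed k w) (linearB (norm_embed k)).
    by rewrite [X in _ - (X - _)]E subrr subr0.
  exact/norm_sub_degenerates/embed_shifted.
- case=> [|k] v; split.
  + move=> [u um <-]; exists (u [::]); apply/funext => -[|x s].
      by rewrite /= embed_empty_nil.
    by rewrite [RHS](shifted_norm um) //; apply: embed_empty_cons.
  + move=> [r <-]; exists (embed_empty r); first exact: embed_empty_shifted.
    exact: norm_embed_empty.
  + move=> [u um <-]; exists (quotmod_pi _ ([ffun w => u (letters w)] : spindle_chains R X k)).
    by rewrite /= quotmod_lift_pi /= embed_onto.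
  + move=> [u <-]; exists (embed (quotmod_repr u)); first exact: embed_shifted.
    by rewrite -[in RHS](quotmod_reprK u) /= quotmod_lift_pi.
- case=> [|k] c; rewrite -[c]quotmod_reprK /= !quotmod_lift_pi /=.
    by rewrite -norm_del -?embed_augmentation ?norm_embed_empty //; case: spX.
  rewrite -norm_del; last by case: spX.
  congr norm; exact: embed_diff.
- by move=> r; rewrite /= /embed_empty linearZ /= del_dirac_nil scaler0.
Qed.

End WordChains.

Theorem corollary6p4 (R : comPzRingType) (X : finType) (op : X -> X -> X)
    (spX : spindle op) (n : nat) :
  lmod_isomorphic (HD R spX n)
    (direct_sum
      (fun p : nat =>
        direct_power (HNred R spX (n%:Z - 1 - p%:Z)) (multiplicity #|X| p))
      n).
Proof.
apply: iso_trans (HD_iso R spX n) _; apply: iso_trans (H_degenerate_sum R spX _) _.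
apply: direct_sum_iso => p /andP[_ pn]; apply/iso_power/iso_sym; exact: HNred_iso.
Qed.
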